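(* Consider the discrete-time stochastic control problem described in the context, with state $X_t=(p_t,q_t)^T$, real control $u_t$, dynamics $$X_{t+\delta t} = \begin{pmatrix} 1-\kappa_t\delta t & 0\\ 0 & 1\end{pmatrix}X_t + a_tu_tw_t\,\delta t+\begin{pmatrix}\alpha_t\delta t+\sigma_{t,\delta t}z_t\\0\end{pmatrix},$$ stage costs $j_t(X,u)\,\delta t$, terminal cost $J_T$ and value function $H$. Let $X=(p,q)^T$, $\mathcal I=\mathrm{diag}(1,1)$, $\mathcal J=\mathrm{diag}(1,0)$, and $e_1=(1,0)^T$. The value function $H$ is quadratic in $X$, of the form $$H(t,X)=X^TP_tX+b_t^TX+e_t.$$ Moreover, the optimal control $u_t^*$ is of the form $$u_t^*=k_t^TX_t+f_t$$ with $$k_t=-\frac1{g_t}\Big((\mathcal I-\kappa_t\delta t\,\mathcal J)P_{t+\delta t}^Tw_t+\tfrac12e_1\Big),$$ $$f_t=-\frac{\big[b_{t+\delta t}^T+2\alpha_t\delta t\,e_1^TP_{t+\delta t}\big]w_t+s_t}{2g_t},\qquad g_t=\eta_t+a_tw_t^TP_{t+\delta t}w_t\,\delta t.$$ Moreover, we have the backward iteration scheme $$P_t=P_{t+\delta t}-\kappa_t\delta t(\mathcal JP_{t+\delta t}+P_{t+\delta t}\mathcal J)+\kappa_t^2(\delta t)^2\mathcal JP_{t+\delta t}\mathcal J+\big[\Delta_t-a_tg_tk_tk_t^T\big]\delta t,$$ $$b_t=b_{t+\delta t}-\big\{2a_tg_tf_tk_t+\kappa_t\mathcal Jb_{t+\delta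 t}-2\alpha_t(\mathcal I-\kappa_t\delta t\,\mathcal J)P_{t+\delta t}e_1\big\}\delta t,$$ $$e_t=e_{t+\delta t}+\big[\sigma_{t,\delta t}^2+\alpha_t^2(\delta t)^2\big]e_1^TP_{t+\delta t}e_1+\big[\alpha_tb_{t+\delta t}^Te_1-a_tg_tf_t^2\big]\delta t,$$ where $\Delta_t=\begin{pmatrix}0&0\\0&\beta_t\end{pmatrix}$, and with the terminal conditions $P_T=\begin{pmatrix}0&0\\0&\tilde\beta_T\end{pmatrix}$, $b_T=(0,0)^T$, $e_T=0$.
   Context: Time grid: $t=0,\delta t,\dots,n\delta t=T$; all sums over time run over the grid. Parameters: $Q_0$ (initial quantity to execute), $v_t$ (expected market volume rate over $[t,t+\delta t)$), $a_t=v_t/Q_0$, $\eta_t$ (deterministic temporary impact), $\mu_t$ (deterministic linear permanent impact), $w_t=(Q_0\mu_t,-1)^T$, $s_t$ (half-spread in proportion of the arrival price), $\kappa_t$ (mean-reversion), $\alpha_t$ (trend signal), $\beta_t$ (urgency), $\tilde\beta_T$ (terminal penalty), $\sigma_{t,\delta t}$ (volatility over a bucket). The $z_t$ are i.i.d. standard normal random variables. State: $X_t=(p_t,q_t)^T$, where $p_t$ is the price slippage and $q_t$ the proportion of non-executed shares. The control $u_t$ (participation rate) is real-valued, with no sign constraint. Costs: for $X=(p,q)^T$, $$j_t(X,u)=a_t\eta_tu^2+a_t(p+s_t)u+\beta_tq^2,\qquad J_T(X)=\tilde\beta_Tq^2.$$ Value function: $$H(t,X)=\inf_{(u_\tau)_{\tau=t,\dots,T-\delta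 t}}\mathbb E\Big[\sum_{\tau=t}^{T-\delta t}j_\tau(X_\tau,u_\tau)\,\delta t+J_T(X_T)\,\Big|\,X_t=X\Big],$$ which satisfies the Bellman equation $H(t,X)=\inf_{u\in\mathbb R}\{j_t(X,u)\delta t+\mathbb E[H(t+\delta t,X_{t+\delta t})\mid X_t=X,u_t=u]\}$. The optimal control is the one attaining the infimum.
   Formalization: The formal theorem assumes that in every state exactly one control attains the infimum in the Bellman equation, and proves this equivalent to a_t g_t > 0 for all t < T; otherwise H can be −∞ or the formulas undefined. Controls are non-anticipative with integrable total cost. *)

(* Defs.v *)
From HB Require Import structures.
From mathcomp Require Import all_boot all_order all_algebra.
From mathcomp Require Import all_classical all_reals all_analysis.

Set Implicit Arguments.
Unset Strict Implicit.
Unset Printing Implicit Defensive.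

Import Order.TTheory GRing.Theory Num.Theory.
Import numFieldNormedType.Exports.

Local Open Scope classical_set_scope.
Local Open Scope ring_scope.

Definition vec2 (R : realType) (x y : R) : 'cV[R]_2 :=
  \col_(i < 2) (if i == 0 then x else y).

Definition diag2 (R : realType) (x y : R) : 'M[R]_2 :=
  diag_mx (\row_(i < 2) (if i == 0 then x else y)).

(* Entry of a 1 x 1 matrix: identifies X^T P X, b^T X, ... with scalars. *)
Definition scal (R : realType) (M : 'M[R]_1) : R := M 0 0.

(* The time t = i * dt is represented by its index i : nat on the grid,
   0 <= i <= nsteps, so that the successor of t is i.+1 and the horizon T is
   nsteps. The values of the coefficients at indices >= nsteps are never used. *)
Record market (R : realType) := Market {
  nsteps : nat;          (* n *)
  dt     : R;            (* delta t *)
  Q0     : R;            (* initial quantity to execute *)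
  vol    : nat -> R;     (* v_t, expected market volume rate *)
  eta    : nat -> R;     (* temporary impact *)
  mu     : nat -> R;     (* linear permanent impact *)
  spread : nat -> R;     (* s_t, half-spread *)
  kappa  : nat -> R;     (* mean reversion *)
  alpha  : nat -> R;     (* trend signal *)
  beta   : nat -> R;     (* urgency *)
  betaT  : R;            (* terminal penalty *)
  sigma  : nat -> R      (* sigma_{t,dt}, volatility over [t, t + dt) *)
}.

Section problem.
Context (R : realType) (m : market R).
Implicit Types (t : nat) (X : 'cV[R]_2).

(* a_t *)
Definition vol_ratio t : R := vol m t / Q0 m.

(* w_t *)
Definition impact t : 'cV[R]_2 := vec2 (Q0 m * mu m t) (- 1).

(* X_{t+dt} when X_t = X, u_t = u and z_t = z. *)
Definition step t X (u z : R) : 'cV[R]_2 :=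
  diag2 (1 - kappa m t * dt m) 1 *m X
  + (vol_ratio t * u * dt m) *: impact t
  + vec2 (alpha m t * dt m + sigma m t * z) 0.

(* In a state X = (p, q)^T, p is X 0 0 and q is X 1 0. *)
Definition stage_cost t X (u : R) : R :=
  vol_ratio t * eta m t * u ^+ 2 + vol_ratio t * (X 0 0 + spread m t) * u
  + beta m t * (X 1 0) ^+ 2.

Definition terminal_cost X : R := betaT m * (X 1 0) ^+ 2.

Section stochastic.
Context d (Omega : measurableType d) (Pr : probability Omega R).
Context (z : nat -> {RV Pr >-> R}).
Implicit Types (u : nat -> Omega -> R).

Definition standard_normal (Z : {RV Pr >-> R}) : Prop :=
  forall B : set R, measurable B -> distribution Pr Z B = normal_prob 0 1 B.

Definition mutually_independent : Prop :=
  forall (J : {set 'I_(nsteps m)}) (B : 'I_(nsteps m) -> set R),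
    (forall i, measurable (B i)) ->
    Pr (\bigcap_(i in [set` J]) (z i @^-1` B i)) =
    (\prod_(i in J) Pr (z i @^-1` B i))%E.

Definition iid_standard_normal : Prop :=
  (forall t, (t < nsteps m)%N -> standard_normal (z t)) /\
  mutually_independent.

(* Information available at time t: the sigma-algebra generated by the shocks
   z_0, ..., z_{t-1}. *)
Definition past t : set_system Omega :=
  <<s [set A | exists s, (s < t)%N /\
                 exists2 B : set R, measurable B & A = z s @^-1` B] >>.

Definition adapted_from t u : Prop :=
  forall tau, (t <= tau < nsteps m)%N ->
    forall B : set R, measurable B -> past tau (u tau @^-1` B).

(* [traj t X u i] is the state i steps after t, started from X at time t. *)
Fixpoint traj t X u (i : nat) (w : Omega) : 'cV[R]_2 :=
  match i with
  | 0 => X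
  | j.+1 => step (t + j) (traj t X u j w) (u (t + j)%N w) (z (t + j)%N w)
  end.

(* X_tau, for tau >= t, when X_t = X. *)
Definition state t X u (tau : nat) : Omega -> 'cV[R]_2 :=
  traj t X u (tau - t).

Definition total_cost t X u (w : Omega) : R :=
  \sum_(t <= tau < nsteps m) stage_cost tau (state t X u tau w) (u tau w) * dt m
  + terminal_cost (state t X u (nsteps m) w).

(* Stage costs have no sign, so the expectation of the total cost only makes
   sense under an integrability condition: controls range over all
   non-anticipative real-valued processes whose total cost is integrable. *)
Definition admissible t X u : Prop :=
  adapted_from t u /\ Pr.-integrable setT (fun w => (total_cost t X u w)%:E).

(* Conditioning on X_t = X is rendered by starting the controlled dynamics from
   the deterministic state X at time t. *)
Definition value t X : \bar R :=
  ereal_inf [set ('E_Pr[total_cost t X u])%E | u in admissible t X].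

Definition optimal t X u : Prop :=
  admissible t X u /\ ('E_Pr[total_cost t X u])%E = value t X.

(* The expression minimized over u in the Bellman equation. *)
Definition bellman t X (u : R) : \bar R :=
  ((stage_cost t X u * dt m)%:E
   + \int[Pr]_w value t.+1 (step t X u (z t w)))%E.

Definition bellman_minimizer t X (u : R) : Prop :=
  bellman t X u = ereal_inf (range (bellman t X)).

(* "The" optimal control makes sense: in every state, exactly one action attains
   the infimum in the Bellman equation. *)
Definition well_posed : Prop :=
  forall t X, (t < nsteps m)%N -> exists! u : R, bellman_minimizer t X u.

End stochastic.

Section coefficients.
Context (P : nat -> 'M[R]_2) (b : nat -> 'cV[R]_2) (e : nat -> R).

Local Notation calI := (diag2 1 1).
Local Notation calJ := (diag2 1 0).
Local Notation e1 := (vec2 1 0).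

Definition coef_g t : R :=
  eta m t + vol_ratio t * scal ((impact t)^T *m P t.+1 *m impact t) * dt m.

Definition coef_k t : 'cV[R]_2 :=
  - (coef_g t)^-1 *:
    ((calI - (kappa m t * dt m) *: calJ) *m (P t.+1)^T *m impact t
     + 2^-1 *: e1).

Definition coef_f t : R :=
  - (scal (((b t.+1)^T + (2 * alpha m t * dt m) *: (e1^T *m P t.+1))
           *m impact t) + spread m t)
  / (2 * coef_g t).

Definition terminal_conditions : Prop :=
  [/\ P (nsteps m) = diag2 0 (betaT m), b (nsteps m) = 0 & e (nsteps m) = 0].

Definition backward_iteration : Prop :=
  forall t, (t < nsteps m)%N ->
  [/\ P t = P t.+1
        - (kappa m t * dt m) *: (calJ *m P t.+1 + P t.+1 *m calJ)
        + ((kappa m t) ^+ 2 * (dt m) ^+ 2) *: (calJ *m P t.+1 *m calJ)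
        + dt m *: (diag2 0 (beta m t)
                   - (vol_ratio t * coef_g t) *: (coef_k t *m (coef_k t)^T)),
      b t = b t.+1
        - dt m *: ((2 * vol_ratio t * coef_g t * coef_f t) *: coef_k t
                   + kappa m t *: (calJ *m b t.+1)
                   - (2 * alpha m t) *:
                     ((calI - (kappa m t * dt m) *: calJ) *m P t.+1 *m e1))
    & e t = e t.+1
        + ((sigma m t) ^+ 2 + (alpha m t) ^+ 2 * (dt m) ^+ 2)
          * scal (e1^T *m P t.+1 *m e1)
        + (alpha m t * scal ((b t.+1)^T *m e1)
           - vol_ratio t * coef_g t * (coef_f t) ^+ 2) * dt m].

Definition quadratic_form t X : R :=
  scal (X^T *m P t *m X) + scal ((b t)^T *m X) + e t.

Definition feedback t X : R := scal ((coef_k t)^T *m X) + coef_f t.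

End coefficients.

End problem.

(* Main.v *)
Require Import Defs.
From HB Require Import structures.
From mathcomp Require Import all_boot all_order all_algebra.
From mathcomp Require Import all_classical all_reals all_analysis.
From mathcomp Require Import measurable_realfun.
From mathcomp Require Import ring lra.

Set Implicit Arguments.
Unset Strict Implicit.
Unset Printing Implicit Defensive.

Import Order.TTheory GRing.Theory Num.Theory.
Import numFieldNormedType.Exports.

Local Open Scope classical_set_scope.
Local Open Scope ring_scope.

(* Completing the square in the Bellman recursion shows, path by path, that the
   total cost of a control started from X at time t equals the quadratic form
   H(t, X), plus the nonnegative deviations a g dt (u - feedback)^2, plus the
   noise terms A z + c (z^2 - 1) in which A and c only depend on the past.
   Since only the total cost of an admissible control is integrable, the noise
   terms need not be; the identity E[total cost] = H(t, X) + E[sum of deviations]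
   is obtained by a backward induction over the time k, localized on events of
   the past of k on which the partial sums are bounded, and extended by monotone
   and dominated convergence. It gives the value, the optimality of the feedback
   and, by strict positivity of a g, its uniqueness. *)

(** Localization works for two reasons. The deviations are nonnegative, so their integral makes
    sense before it is known to be finite. And on an event of the past of [k] where [partial_sum k]
    is bounded, the rest of the sum is integrable because the whole sum is, even though the states
    of an arbitrary admissible control need not have moments. The condition that [a g] be positive
    is strict convexity of the Bellman expression, a parabola in the action with leading coefficient
    [a g dt]. It has to be extracted from [well_posed] date by date, starting at the horizon: the
    expression at a date is known to be a parabola only once the value at the next date is known to
    be quadratic. The sequences [P], [b], [e] can nevertheless be built beforehand, because
    inversion is total. Symmetry of [P], inherited from the terminal matrix, is what makes [coef_k]
    and [coef_f] describe the vertex of the parabola. *)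

(** * First two moments of the standard normal law *)

Section normal_moments.
Context (R : realType).
Local Notation mu := (@lebesgue_measure R).

Import HBNNSimple.

(** [normal_prob] gives the mass of a set as an integral of the density. Linearity extends this to
    simple functions, and monotone convergence on both sides to nonnegative ones. *)
Lemma ge0_integral_normal_prob (m s : R) (f : measurableTypeR R -> R) :
  measurable_fun setT f -> (forall x, 0 <= f x) ->
  (\int[normal_prob m s]_x (f x)%:E =
   \int[mu]_x (f x * normal_pdf m s x)%:E)%E.
Proof.
move=> mf f0.
have mfE : measurable_fun setT (EFin \o f) by exact/measurable_EFinP.
pose g := nnsfun_approx measurableT mfE.
have mpdf := measurable_normal_pdf m s.
have gE n : (\int[normal_prob m s]_x (g n x)%:E =
    \int[mu]_x (g n x * normal_pdf m s x)%:E)%E.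
  rewrite integralT_nnsfun sintegralE.
  transitivity (\sum_(r \in range (g n))
     (\int[mu]_x (r * (\1_(g n @^-1` [set r]) x * normal_pdf m s x))%:E))%E.
    apply: eq_fsbigr => r; rewrite inE => -[x _ <-].
    under [RHS]eq_integral do rewrite EFinM.
    rewrite ge0_integralZl//; first last.
    - by rewrite lee_fin.
    - by move=> y _; rewrite lee_fin mulr_ge0 ?normal_pdf_ge0.
    - apply/measurable_EFinP/measurable_funM => //.
    congr (_ * _)%E; rewrite /normal_prob [LHS]integral_mkcond.
    by apply: eq_integral => y _; rewrite epatch_indic/= muleC.
  rewrite -ge0_integral_fsum//.
  - apply: eq_integral => x _; rewrite [in RHS](fimfunE (g n) x).
    rewrite fsumEFin; last by exact: fimfunP.
    congr EFin; rewrite !fsbig_finite//= mulr_suml.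
    by apply: eq_bigr => r _; rewrite mulrA.
  - move=> r; apply/measurable_EFinP/measurable_funM => //.
    by apply: measurable_funM => //.
  - move=> r x _; rewrite lee_fin mulrA mulr_ge0 ?normal_pdf_ge0//.
    rewrite indicE; case: (boolP (x \in _)) => [|_]; last by rewrite mulr0.
    by rewrite inE => /= <-; rewrite mulr1.
transitivity (limn (fun n => \int[normal_prob m s]_x (g n x)%:E))%E.
  rewrite -monotone_convergence//.
  - apply: eq_integral => x _; apply/esym/cvg_lim => //.
    by apply: cvg_nnsfun_approx => // y _; rewrite lee_fin.
  - by move=> n; exact/measurable_EFinP.
  - by move=> n x _; rewrite lee_fin.
  - by move=> x _ a b ab; rewrite lee_fin; exact/lefP/nd_nnsfun_approx.
under eq_fun do rewrite gE.
rewrite -monotone_convergence//.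
- apply: eq_integral => x _; apply/cvg_lim => //.
  under eq_fun do rewrite EFinM; rewrite EFinM.
  by apply: cvgeZr => //; apply: cvg_nnsfun_approx => // y _; rewrite lee_fin.
- by move=> n; apply/measurable_EFinP/measurable_funM.
- by move=> n x _; rewrite lee_fin mulr_ge0// normal_pdf_ge0.
- move=> x _ a b ab; rewrite lee_fin ler_wpM2r ?normal_pdf_ge0//.
  exact/lefP/nd_nnsfun_approx.
Qed.

Let psi (x : R) := expR (- x ^+ 2 / 2).

Let psi_pdf x : normal_pdf 0 1 x = normal_peak 1 * psi x.
Proof.
rewrite normal_pdfE ?oner_eq0//; congr (_ * expR _).
by rewrite subr0 expr1n.
Qed.

Let dpsi x : is_derive x (1 : R) psi (- (x * psi x)).
Proof.
have h : is_derive x (1 : R) (fun y : R => - y ^+ 2 / 2) (- x).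
  apply: is_derive_eq; rewrite /GRing.scale/= ?expr1 ?mulr1 ?mul1r.
  by field.
have := @is_derive1_comp _ expR (fun y : R => - y ^+ 2 / 2) x _ _ (is_derive_expR _) h.
by rewrite mulrN mulrC /psi.
Qed.

Let cpsi : continuous psi.
Proof.
move=> x; apply: differentiable_continuous; apply/derivable1_diffP.
by have [] := dpsi x.
Qed.

Let psi_ge0 x : 0 <= psi x. Proof. exact: expR_ge0. Qed.

Let psi_sym x : psi (- x) = psi x. Proof. by rewrite /psi sqrrN. Qed.

(** This is the boundary term of the integration by parts for the second moment; [expR y >= 1 + y]
    at [y = n ^+ 2 / 2] bounds it by [2 / n]. *)
Let cvg_npsi : (n%:R * psi n%:R) @[n --> \oo] --> (0 : R).
Proof.
apply: (@squeeze_cvgr _ _ _ _ (cst 0) (fun n => 2 * n%:R^-1)).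
- apply: nearW => n; rewrite mulr_ge0//=.
  have [->|n0] := eqVneq n 0%N; first by rewrite mul0r invr0 mulr0.
  have n0' : (0 : R) < n%:R by rewrite ltr0n lt0n.
  rewrite /psi mulNr expRN ler_pdivrMr ?expR_gt0// mulrAC ler_pdivlMr// -expr2.
  have := @expR_ge1Dx R (n%:R ^+ 2 / 2); lra.
- exact: cvg_cst.
- rewrite -[X in _ --> X](mulr0 2); apply: cvgM; first exact: cvg_cst.
  apply/gtr0_cvgV0; last exact: cvgr_idn.
  by exists 1%N => // n /=; rewrite ltr0n.
Qed.

(** Integration by parts on bounded intervals, [x * psi x] being the derivative of [- psi], followed
    by a passage to the limit. *)
Let halfline_moment2 : (\int[mu]_(x in `[0%R, +oo[) (x * (x * psi x))%:E =
  \int[mu]_(x in `[0%R, +oo[) (psi x)%:E)%E.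
Proof.
have mpsi : measurable_fun setT psi by exact: continuous_measurable_fun.
have c1 := @ge0_cvgn_integral R mu psi psi_ge0 mpsi.
have h0 (x : R) : 0 <= x * (x * psi x).
  by rewrite mulrA -expr2 mulr_ge0// sqr_ge0.
have c2 := @ge0_cvgn_integral R mu (fun x => x * (x * psi x)) h0.
have mh : measurable_fun setT (fun x : R => x * (x * psi x)).
  by apply: measurable_funM => //; exact: measurable_funM.
move: (c2 mh) => /cvg_lim => <- //.
apply/cvg_lim => //.
rewrite -[X in _ --> X]add0e.
have parts n : (\int[mu]_(x in `[0%R, n.+1%:R]) (x * (x * psi x))%:E =
   (- (n.+1%:R * psi n.+1%:R))%:E + \int[mu]_(x in `[0%R, n.+1%:R]) (psi x)%:E)%E.
  have cxpsi : continuous (fun x : R => x * psi x).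
    by move=> x; apply: cvgM; [exact: cvg_id | exact: cpsi].
  have cN : continuous (fun y : R => - psi y) by move=> x; exact/continuousN/cpsi.
  have dN x : is_derive x (1 : R) (fun y => - psi y) (x * psi x).
    by rewrite -[x * _]opprK; apply: is_deriveN.
  rewrite (@integration_by_parts R id (fun x : R => - psi x) (cst 1) (fun x : R => x * psi x)).
  - rewrite mul0r subr0 mulrN; congr (_ + _)%E.
    under eq_integral do rewrite mul1r EFinN.
    by rewrite integral_ge0N ?oppeK// => x _; rewrite lee_fin.
  - by rewrite ltr0n.
  - by apply: continuous_subspaceT => x; exact: cvg_cst.
  - split => [x _||]; first exact: derivable_id.
    + by apply: cvg_at_right_filter; exact: cvg_id.
    + by apply: cvg_at_left_filter; exact: cvg_id.
  - by move=> x _; rewrite derive1E derive_id.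
  - exact: continuous_subspaceT.
  - split => [x _||].
    + by have [] := dN x.
    + by apply: cvg_at_right_filter; exact: cN.
    + by apply: cvg_at_left_filter; exact: cN.
  - by move=> x _; rewrite derive1E; exact: derive_val.
(* The shift discards the degenerate interval from 0 to 0, on which integration by parts does not
   apply. *)
rewrite -cvg_shiftS/=; under eq_cvg do rewrite parts.
apply: cvgeD => //; last by move: c1; rewrite -cvg_shiftS.
rewrite -[0%E]/(0%R%:E) -[0%R]oppr0.
apply: cvg_EFin; first exact: nearW.
by apply: cvgN; move: cvg_npsi; rewrite -cvg_shiftS.
Qed.


(** The Gaussian integral is not computed: the second moment is compared with the total mass of the
    density. Both integrands are even, and their half-line integrals agree. *)
Lemma normal_moment2 : (\int[normal_prob 0 1]_x (x ^+ 2)%:E = 1 :> \bar R)%E.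
Proof.
have m2 : measurable_fun setT (fun x : R => x ^+ 2 * psi x).
  apply: measurable_funM; first exact: measurable_funX.
  exact: continuous_measurable_fun.
have mpsi : measurable_fun setT psi by exact: continuous_measurable_fun.
have pk : 0 <= normal_peak 1 :> R by exact: normal_peak_ge0.
have c2 : continuous (fun x : R => x ^+ 2 * psi x).
  by move=> x; apply: cvgM; [exact: sqr_continuous | exact: cpsi].
rewrite (@ge0_integral_normal_prob 0 1 (fun x => x ^+ 2)); last 2 first.
- exact: measurable_funX.
- by move=> x; exact: sqr_ge0.
rewrite -[RHS](@integral_normal_pdf R 0 1).
under eq_integral do rewrite psi_pdf mulrCA EFinM.
under [RHS]eq_integral do rewrite psi_pdf EFinM.
rewrite !ge0_integralZl_EFin//; last 4 first.
- by move=> x _; rewrite lee_fin.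
- exact/measurable_EFinP.
- by move=> x _; rewrite lee_fin mulr_ge0// sqr_ge0.
- exact/measurable_EFinP.
congr (_ * _)%E.
rewrite (@ge0_symfun_integralT R psi)//; last by move=> x; rewrite /= psi_sym.
rewrite (@ge0_symfun_integralT R (fun x => x ^+ 2 * psi x))//; last 2 first.
- by move=> x; rewrite mulr_ge0// sqr_ge0.
- by move=> x; rewrite /= psi_sym sqrrN.
rewrite -set_itvcy -halfline_moment2; congr (_ * _)%E.
by apply: eq_integral => x _; rewrite mulrA -expr2.
Qed.

Lemma integrable_normal_id :
  (normal_prob 0 1).-integrable [set: measurableTypeR R] (fun x => x%:E).
Proof.
have m2 : measurable_fun setT (fun x : R => x ^+ 2) by exact: measurable_funX.
have i2 : (normal_prob 0 1).-integrable [set: measurableTypeR R] (fun x => (1 + x ^+ 2)%:E).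
  apply/integrableP; split.
    by apply/measurable_EFinP; apply: measurable_funD.
  under eq_integral => x _.
    rewrite gee0_abs; last by rewrite lee_fin addr_ge0// sqr_ge0.
    rewrite EFinD; over.
  rewrite ge0_integralD//.
  - rewrite integral_cst// normal_moment2.
    rewrite [X in (1 * X)%E](_ : _ = 1%E); last exact: integral_normal_pdf.
    by rewrite mule1 -EFinD ltry.
  - by move=> x _; rewrite lee_fin sqr_ge0.
  - exact/measurable_EFinP.
apply: le_integrable i2 => //; first exact/measurable_EFinP.
move=> x _ /=; rewrite lee_fin [leRHS]ger0_norm ?addr_ge0 ?sqr_ge0//.
rewrite ler_norml; apply/andP; split; nra.
Qed.

(** The substitution of [- x] for [x] exchanges the positive and negative parts, whose integrals are
    finite and therefore cancel. *)
Lemma normal_mean : (\int[normal_prob 0 1]_x x%:E = 0 :> \bar R)%E.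
Proof.
have mid : measurable_fun [set: measurableTypeR R] (fun x => x%:E) by exact/measurable_EFinP.
have mpos : measurable_fun [set: measurableTypeR R] (fun x => Num.max x 0).
  exact: measurable_maxr.
have mneg : measurable_fun [set: measurableTypeR R] (fun x => Num.max (- x) 0).
  exact: measurable_maxr.
have pos0 (x : R) : 0 <= Num.max x 0 by rewrite le_max lexx orbT.
rewrite integralE.
suff <- : (\int[normal_prob 0 1]_x (fun x => x%:E)^\+ x =
          \int[normal_prob 0 1]_x (fun x => x%:E)^\- x :> \bar R)%E.
  by rewrite subee//; exact: integrable_pos_fin_num integrable_normal_id.
under eq_integral do rewrite funeposE -EFin_max.
under [RHS]eq_integral do rewrite funenegE -EFinN -EFin_max.
rewrite (@ge0_integral_normal_prob 0 1 _ mpos)//.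
rewrite (@ge0_integral_normal_prob 0 1 _ mneg)//.
pose f (x : R) := Num.max x 0 * normal_pdf 0 1 x.
have pdfN x : normal_pdf 0 1 (- x) = normal_pdf 0 1 x :> R.
  by rewrite !psi_pdf psi_sym.
pose h (x : R) := f (- x).
have f0 x : 0 <= f x by rewrite mulr_ge0// normal_pdf_ge0.
have cf : continuous f.
  move=> x; apply: cvgM; last by apply: continuous_normal_pdf; rewrite oner_eq0.
  by apply: (@continuous_max R R id (cst 0)); [exact: cvg_id|exact: cvg_cst].
have ch : continuous h.
  by move=> x; apply: (@continuous_comp _ _ _ (fun x => - x) f); [exact: opp_continuous|exact: cf].
have -> : (\int[mu]_x (Num.max x 0 * normal_pdf 0 1 x)%:E =
           \int[mu]_(x in `[0%R, +oo[) (f x)%:E)%E.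
  rewrite [RHS]integral_mkcond; apply: eq_integral => x _.
  rewrite patchE; case: ifPn => //; rewrite notin_setE/= in_itv/= andbT => /negP.
  by rewrite -ltNge => x0; rewrite /f max_r ?ltW// mul0r.
have -> : (\int[mu]_x (Num.max (- x) 0 * normal_pdf 0 1 x)%:E =
           \int[mu]_(x in `]-oo, (- 0)%R]) (h x)%:E)%E.
  rewrite [RHS]integral_mkcond; apply: eq_integral => x _.
  rewrite patchE /h /f pdfN; case: ifPn => //; rewrite notin_setE/= in_itv/= oppr0 => /negP.
  by rewrite -ltNge => x0; rewrite max_r ?mul0r// oppr_le0 ltW.
rewrite ge0_integration_by_substitutionNy; last 2 first.
- exact: continuous_subspaceT.
- by move=> x _; exact: f0.
by under [RHS]eq_integral do rewrite /h /= opprK.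
Qed.

End normal_moments.

(** * Expectation of a product of independent factors *)

Section independence.
Context d d1 d2 (T : measurableType d) (T1 : measurableType d1)
  (T2 : measurableType d2) (R : realType) (P : probability T R).

Lemma integrable_expectationM_indep (X : {mfun T >-> T1}) (Y : {mfun T >-> T2})
    (f : T1 -> R) (g : T2 -> R) :
  (forall A B, measurable A -> measurable B ->
     P (X @^-1` A `&` Y @^-1` B) = (P (X @^-1` A) * P (Y @^-1` B))%E) ->
  measurable_fun setT f -> measurable_fun setT g ->
  P.-integrable setT (fun w => (f (X w))%:E) ->
  P.-integrable setT (fun w => (g (Y w))%:E) ->
  P.-integrable setT (fun w => (f (X w) * g (Y w))%:E) /\
  (\int[P]_w (f (X w) * g (Y w))%:E =
   (\int[P]_w (f (X w))%:E) * (\int[P]_w (g (Y w))%:E))%E.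
Proof.
move=> XY mf mg iX iY.
pose XYf (w : T) : T1 * T2 := (X w, Y w).
have mXY : measurable_fun setT XYf by apply: measurable_fun_pair.
pose XYm : {mfun T >-> _} :=
  MeasurableFun.Pack (MeasurableFun.Class (isMeasurableFun.Build _ _ _ _ _ mXY)).
pose muX := distribution P X.
pose muY := distribution P Y.
pose muXY := distribution P XYm.
pose h (xy : T1 * T2) : \bar R := (f xy.1 * g xy.2)%:E.
have mh : measurable_fun setT h.
  by apply/measurable_EFinP; apply: measurable_funM; apply: measurableT_comp.
have prodE S : measurable S -> (muX \x muY)%E S = muXY S.
  move=> mS; apply: product_measure_unique => //.
have mEf : measurable_fun setT (EFin \o f) by exact/measurable_EFinP.
have mEg : measurable_fun setT (EFin \o g) by exact/measurable_EFinP.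
have iX' : muX.-integrable setT (EFin \o f).
  by apply: (@integrable_pushforward _ _ _ _ _ X (@measurable_funPT _ _ _ _ X)).
have iY' : muY.-integrable setT (EFin \o g).
  by apply: (@integrable_pushforward _ _ _ _ _ Y (@measurable_funPT _ _ _ _ Y)).
have ih : (muX \x muY)%E.-integrable setT h.
  apply/integrable12ltyP => //.
  under eq_integral => x _.
    under eq_integral do rewrite /h/= normrM EFinM.
    rewrite ge0_integralZl//; last by apply/measurable_EFinP; exact: measurableT_comp.
    over.
  rewrite ge0_integralZr//; last 2 first.
    by apply/measurable_EFinP; exact: measurableT_comp.
    exact: integral_ge0.
  move/integrableP : iX' => [_ iX']; move/integrableP : iY' => [_ iY'].
  by rewrite lte_mul_pinfty// ?integral_ge0// ge0_fin_numE// integral_ge0.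
have ihXY : muXY.-integrable setT h.
  apply/integrableP; split => //; move/integrableP: ih => [_].
  by rewrite (@eq_measure_integral _ _ _ _ muXY (muX \x muY)%E)// => A mA _; exact: prodE.
have iXY : P.-integrable setT (h \o XYf).
  apply/integrableP; split; first exact: measurableT_comp.
  move/integrableP : ihXY => [_]; rewrite ge0_integral_distribution//.
  exact: measurableT_comp.
split => //.
have -> : (\int[P]_w (f (X w) * g (Y w))%:E = \int[muXY]_x h x)%E.
  by rewrite integral_distribution.
rewrite -(@eq_measure_integral _ _ _ _ muXY (muX \x muY)%E); last first.
  by move=> A mA _; exact: prodE.
rewrite -integral12_prod_meas1// /fubini_F.
under eq_integral => x _.
  under eq_integral do rewrite /h/= EFinM.
  rewrite integralZl//; over.
rewrite /=.
have -> : (\int[P]_w (f (X w))%:E = \int[muX]_x (f x)%:E)%E by rewrite integral_distribution.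
have -> : (\int[P]_w (g (Y w))%:E = \int[muY]_x (g x)%:E)%E by rewrite integral_distribution.
have /fineK <- := integrable_fin_num measurableT iY'.
by rewrite integralZr.
Qed.

End independence.

(** * The sigma-algebra of past shocks *)

Section past.
Context (R : realType) (m : market R) d (Omega : measurableType d)
  (Pr : probability Omega R) (z : nat -> {RV Pr >-> R}).

Lemma past_measurable t (A : set Omega) : past z t A -> measurable A.
Proof.
apply: smallest_sub; first exact: sigma_algebra_measurable.
by move=> _ [s [_ [B mB ->]]]; rewrite -[X in measurable X]setTI; exact: measurable_funPT.
Qed.

Lemma past_preimage s t (B : set R) : (s < t)%N -> measurable B ->
  past z t (z s @^-1` B).
Proof. by move=> st mB; apply: sub_sigma_algebra; exists s; split => //; exists B. Qed.

Lemma sub_past s t : (s <= t)%N -> past z s `<=` past z t.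
Proof.
move=> st; apply: smallest_sub; first exact: smallest_sigma_algebra.
move=> _ [r [rs [B mB ->]]]; apply: past_preimage => //.
exact: leq_trans rs st.
Qed.

(** Cylinder events form a family stable under intersection that generates the past. As functions of
    [A], both sides are finite measures, and mutual independence makes them agree on cylinders. *)
Lemma past_independent t (A : set Omega) (B : set R) :
  mutually_independent m z -> (t < nsteps m)%N -> past z t A -> measurable B ->
  Pr (A `&` z t @^-1` B) = (Pr A * Pr (z t @^-1` B))%E.
Proof.
move=> ind tn pA mB.
have mzB s C : measurable C -> measurable (z s @^-1` C).
  by move=> mC; rewrite -[X in measurable X]setTI; exact: measurable_funPT.
pose C : set_system Omega := [set A | exists2 B : nat -> set R,
  forall s, measurable (B s) & A = \bigcap_(s in `I_t) (z s @^-1` B s)].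
have mC : C `<=` measurable.
  move=> _ [F mF ->]; apply: bigcap_measurableType => s _; exact: mzB.
have CT : C setT.
  by exists (fun=> setT) => //; apply/esym/bigcapT.
have CI : setI_closed C.
  move=> _ _ [F mF ->] [G mG ->]; exists (fun s => F s `&` G s).
    by move=> s; exact: measurableI.
  by rewrite -bigcapI; apply: eq_bigcapr => s _; rewrite preimage_setI.
have pC : past z t `<=` <<s C >>.
  apply: smallest_sub; first exact: smallest_sigma_algebra.
  move=> _ [s [st [F mF ->]]]; apply: sub_sigma_algebra.
  exists (fun r => if r == s then F else setT); first by move=> r; case: ifP.
  apply/seteqP; split => w /=.
    by move=> Fw r _; case: eqP => [->|].
  by move=> /(_ s st); rewrite eqxx.
have r0 : 0 <= fine (Pr (z t @^-1` B)) by exact: fine_ge0.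
pose m1 := mrestr Pr (mzB t B mB).
pose m2 := mscale (NngNum r0) Pr.
have rE : ((NngNum r0)%:num)%:E = Pr (z t @^-1` B).
  by rewrite /= fineK// fin_num_measure//; exact: (mzB _ _ mB).
have -> : Pr (A `&` z t @^-1` B) = m1 A by [].
have -> : (Pr A * Pr (z t @^-1` B))%E = m2 A by rewrite muleC /m2 /mscale/= -rE.
apply: (@g_sigma_algebra_measure_unique _ _ _ C mC (fun=> setT) _ _ m1 m2 CI _ _ A (pC _ pA)) => //.
- by rewrite bigcup_const.
- move=> _ [F mF ->].
  (* Mutual independence is stated for finite sets of ordinals: [J] indexes the cylinder, [J'] adds
     the date [t], and [G] carries [F] before [t] and [B] from [t] on. *)
  pose J := [set i : 'I_(nsteps m) | (i < t)%N]%SET.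
  pose J' := [set i : 'I_(nsteps m) | (i <= t)%N]%SET.
  pose G (i : 'I_(nsteps m)) := if (i < t)%N then F i else B.
  have mG i : measurable (G i) by rewrite /G; case: ifP.
  have E1 : \bigcap_(s in `I_t) (z s @^-1` F s) = \bigcap_(i in [set` J]) (z i @^-1` G i).
    apply/seteqP; split => w /= h.
      by move=> i /=; rewrite finset.inE => it; rewrite /G it; exact: h.
    move=> s /= st; have /= hs := h (Ordinal (ltn_trans st tn)).
    by move: hs; rewrite /G /= st; apply; rewrite finset.inE.
  have E2 : \bigcap_(s in `I_t) (z s @^-1` F s) `&` z t @^-1` B =
            \bigcap_(i in [set` J']) (z i @^-1` G i).
    rewrite E1; apply/seteqP; split => w /=.
      move=> [h1 h2] i /=; rewrite finset.inE leq_eqVlt => /orP[/eqP it|it].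
        by rewrite /G it ltnn.
      by apply: h1; rewrite /= inE.
    move=> h; split.
      by move=> i /=; rewrite finset.inE => it; apply: h; rewrite /= inE ltnW.
    have /= ht := h (Ordinal tn).
    by move: ht; rewrite /G /= ltnn; apply; rewrite finset.inE /=.
  suff : Pr (\bigcap_(s in `I_t) (z s @^-1` F s) `&` z t @^-1` B) =
      ((fine (Pr (z t @^-1` B)))%:E * Pr (\bigcap_(s in `I_t) (z s @^-1` F s)))%E by [].
  rewrite E2 E1 !ind//.
  rewrite (bigD1 (Ordinal tn)) ?inE//= /G /= ltnn fineK; last first.
    by rewrite fin_num_measure//; exact: (mzB _ _ mB).
  congr (_ * _)%E; apply: eq_bigl => i; rewrite !inE -val_eqE /=.
  by rewrite andbC -ltn_neqAle.
- move=> _; apply: (@le_lt_trans _ _ 1%E); last exact: ltry.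
  by apply: probability_le1; rewrite setTI; exact: (mzB _ _ mB).
Qed.

End past.

(** * Algebra of the Bellman recursion *)

Section algebra.
Context (R : realType) (m : market R).

Lemma sum_ord2 (V : nmodType) (F : 'I_2 -> V) : \sum_i F i = F 0 + F 1.
Proof.
by rewrite !big_ord_recl big_ord0 addr0; congr (F _ + F _); exact: val_inj.
Qed.

Lemma sum_ord1 (V : nmodType) (F : 'I_1 -> V) : \sum_i F i = F 0.
Proof. by rewrite big_ord_recl big_ord0 addr0. Qed.

Lemma stepE0 t (X : 'cV[R]_2) u z : step m t X u z 0 0 =
  (1 - kappa m t * dt m) * X 0 0 + vol_ratio m t * u * dt m * (Q0 m * mu m t)
  + (alpha m t * dt m + sigma m t * z).
Proof. by rewrite !(mxE, sum_ord2)/= mulr1n mulr0n; ring. Qed.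

Lemma stepE1 t (X : 'cV[R]_2) u z : step m t X u z 1 0 =
  X 1 0 - vol_ratio m t * u * dt m.
Proof. by rewrite !(mxE, sum_ord2)/= mulr1n mulr0n; ring. Qed.

Lemma quadratic_formE P b e t (X : 'cV[R]_2) : quadratic_form P b e t X =
  P t 0 0 * X 0 0 ^+ 2 + (P t 0 1 + P t 1 0) * X 0 0 * X 1 0 + P t 1 1 * X 1 0 ^+ 2
  + (b t 0 0 * X 0 0 + b t 1 0 * X 1 0) + e t.
Proof. by rewrite /quadratic_form /scal !(mxE, sum_ord2); ring. Qed.

Lemma coef_gE P t : coef_g m P t = Defs.eta m t + vol_ratio m t *
  (P t.+1 0 0 * (Q0 m * mu m t) ^+ 2 - (P t.+1 0 1 + P t.+1 1 0) * (Q0 m * mu m t)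
   + P t.+1 1 1) * dt m.
Proof. by rewrite /coef_g /scal !(mxE, sum_ord2)/=; ring. Qed.

Lemma coef_kE0 P t : coef_k m P t 0 0 = - (coef_g m P t)^-1 *
  ((1 - kappa m t * dt m) * (P t.+1 0 0 * (Q0 m * mu m t) - P t.+1 1 0) + 2^-1).
Proof. by rewrite /coef_k !(mxE, sum_ord2)/= !(mulr1n, mulr0n); ring. Qed.

Lemma coef_kE1 P t : coef_k m P t 1 0 = - (coef_g m P t)^-1 *
  (P t.+1 0 1 * (Q0 m * mu m t) - P t.+1 1 1).
Proof. by rewrite /coef_k !(mxE, sum_ord2)/= !(mulr1n, mulr0n); ring. Qed.

Lemma coef_fE P b t : coef_f m P b t =
  - ((b t.+1 0 0 + 2 * alpha m t * dt m * P t.+1 0 0) * (Q0 m * mu m t)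
     - (b t.+1 1 0 + 2 * alpha m t * dt m * P t.+1 0 1) + spread m t)
  / (2 * coef_g m P t).
Proof. by rewrite /coef_f /scal !(mxE, sum_ord2)/=; congr (- _ / _); ring. Qed.

Lemma feedbackE P b t (X : 'cV[R]_2) : feedback m P b t X =
  coef_k m P t 0 0 * X 0 0 + coef_k m P t 1 0 * X 1 0 + coef_f m P b t.
Proof. by rewrite /feedback /scal mxE sum_ord2 ![_^T _ _]mxE. Qed.

(** The coefficient of the first power of the shock in the next quadratic form; [shock_coef2] is
    that of its square. *)
Definition shock_coef (P : nat -> 'M[R]_2) (b : nat -> 'cV[R]_2) t (X : 'cV[R]_2) u : R :=
  sigma m t * (2 * P t.+1 0 0 * step m t X u 0 0 0
    + (P t.+1 0 1 + P t.+1 1 0) * step m t X u 0 1 0 + b t.+1 0 0).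

Definition shock_coef2 (P : nat -> 'M[R]_2) t : R := sigma m t ^+ 2 * P t.+1 0 0.

(** A quadratic form of an affine function of [z] has degree two in [z]. Splitting [z ^+ 2] as
    [1 + (z ^+ 2 - 1)] leaves a centred noise and moves the variance into the deterministic part. *)
Lemma quadratic_form_step P b e t (X : 'cV[R]_2) u z :
  quadratic_form P b e t.+1 (step m t X u z) =
  quadratic_form P b e t.+1 (step m t X u 0) + shock_coef2 P t
  + (shock_coef P b t X u * z + shock_coef2 P t * (z ^+ 2 - 1)).
Proof.
rewrite !quadratic_formE /shock_coef /shock_coef2 !stepE0 !stepE1; ring.
Qed.

(* The coefficient of [a_t u dt] in the expression minimized over [u] in the
   Bellman equation. *)
Definition linear_coef (P : nat -> 'M[R]_2) (b : nat -> 'cV[R]_2) t (X : 'cV[R]_2) : R :=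
  (X 0 0 + spread m t
   + (1 - kappa m t * dt m) * X 0 0 * (2 * P t.+1 0 0 * (Q0 m * mu m t) - (P t.+1 0 1 + P t.+1 1 0))
   + X 1 0 * ((P t.+1 0 1 + P t.+1 1 0) * (Q0 m * mu m t) - 2 * P t.+1 1 1)
   + alpha m t * dt m * (2 * P t.+1 0 0 * (Q0 m * mu m t) - (P t.+1 0 1 + P t.+1 1 0))
   + b t.+1 0 0 * (Q0 m * mu m t) - b t.+1 1 0).

Lemma bellman_quadraticE P b e t (X : 'cV[R]_2) u :
  stage_cost m t X u * dt m + quadratic_form P b e t.+1 (step m t X u 0) =
  vol_ratio m t * coef_g m P t * dt m * u ^+ 2
  + vol_ratio m t * dt m * linear_coef P b t X * u
  + (stage_cost m t X 0 * dt m + quadratic_form P b e t.+1 (step m t X 0 0)).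
Proof.
rewrite !quadratic_formE coef_gE /stage_cost /linear_coef !stepE0 !stepE1; ring.
Qed.

(** This puts the vertex of the parabola at the feedback. The linear coefficient contains the sum of
    the off-diagonal entries of [P], whereas [coef_k] and [coef_f] contain only one of them:
    symmetry reconciles the two. *)
Lemma linear_coefE (P : nat -> 'M[R]_2) (b : nat -> 'cV[R]_2) t X :
  P t.+1 0 1 = P t.+1 1 0 -> coef_g m P t != 0 ->
  linear_coef P b t X = - (2 * coef_g m P t * feedback m P b t X).
Proof.
move=> sP g0; rewrite feedbackE coef_kE0 coef_kE1 coef_fE /linear_coef sP.
by field.
Qed.

(** The backward iteration says exactly that the minimum of the parabola is the quadratic form at
    time [t]; [shock_coef2] accounts for the variance term in the recursion of [e]. *)
Lemma complete_square (P : nat -> 'M[R]_2) b e t (X : 'cV[R]_2) u :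
  backward_iteration m P b e -> (t < nsteps m)%N -> P t.+1 0 1 = P t.+1 1 0 ->
  coef_g m P t != 0 ->
  stage_cost m t X u * dt m
  + (quadratic_form P b e t.+1 (step m t X u 0) + shock_coef2 P t) =
  quadratic_form P b e t X
  + vol_ratio m t * coef_g m P t * dt m * (u - feedback m P b t X) ^+ 2.
Proof.
move=> back tn sP g0; rewrite addrA bellman_quadraticE linear_coefE//.
have [EP Eb Ee] := back _ tn.
(* Entry by entry, and with [coef_g], [coef_k], [coef_f] kept as atoms, no inverse remains and the
   claim becomes a polynomial identity. *)
have P00 : P t 0 0 = (1 - kappa m t * dt m) ^+ 2 * P t.+1 0 0
    - vol_ratio m t * coef_g m P t * dt m * coef_k m P t 0 0 ^+ 2.
  by rewrite EP !(mxE, sum_ord2, sum_ord1)/= !(mulr1n, mulr0n); ring.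
have P01 : P t 0 1 = (1 - kappa m t * dt m) * P t.+1 0 1
    - vol_ratio m t * coef_g m P t * dt m * coef_k m P t 0 0 * coef_k m P t 1 0.
  by rewrite EP !(mxE, sum_ord2, sum_ord1)/= !(mulr1n, mulr0n); ring.
have P10 : P t 1 0 = (1 - kappa m t * dt m) * P t.+1 1 0
    - vol_ratio m t * coef_g m P t * dt m * coef_k m P t 0 0 * coef_k m P t 1 0.
  by rewrite EP !(mxE, sum_ord2, sum_ord1)/= !(mulr1n, mulr0n); ring.
have P11 : P t 1 1 = P t.+1 1 1 + beta m t * dt m
    - vol_ratio m t * coef_g m P t * dt m * coef_k m P t 1 0 ^+ 2.
  by rewrite EP !(mxE, sum_ord2, sum_ord1)/= !(mulr1n, mulr0n); ring.
have b0 : b t 0 0 = (1 - kappa m t * dt m) * b t.+1 0 0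
    + 2 * alpha m t * dt m * (1 - kappa m t * dt m) * P t.+1 0 0
    - 2 * vol_ratio m t * coef_g m P t * dt m * coef_f m P b t * coef_k m P t 0 0.
  by rewrite Eb !(mxE, sum_ord2, sum_ord1)/= !(mulr1n, mulr0n); ring.
have b1 : b t 1 0 = b t.+1 1 0
    + 2 * alpha m t * dt m * P t.+1 1 0
    - 2 * vol_ratio m t * coef_g m P t * dt m * coef_f m P b t * coef_k m P t 1 0.
  by rewrite Eb !(mxE, sum_ord2, sum_ord1)/= !(mulr1n, mulr0n); ring.
have eE : e t = e t.+1 + (sigma m t ^+ 2 + alpha m t ^+ 2 * dt m ^+ 2) * P t.+1 0 0
    + (alpha m t * b t.+1 0 0 - vol_ratio m t * coef_g m P t * coef_f m P b t ^+ 2) * dt m.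
  by rewrite Ee /scal !(mxE, sum_ord2, sum_ord1)/=; ring.
rewrite !quadratic_formE P00 P01 P10 P11 b0 b1 eE feedbackE !stepE0 !stepE1
  /shock_coef2 /stage_cost sP; ring.
Qed.

(** The terminal matrix is diagonal and every term of the recursion preserves symmetry; the
    induction runs on the distance to the horizon. *)
Lemma backward_iteration_sym P b e t :
  terminal_conditions m P b e -> backward_iteration m P b e ->
  (t <= nsteps m)%N -> P t 0 1 = P t 1 0.
Proof.
move=> [PT _ _] back tn.
rewrite -(subKn tn); elim: (nsteps m - t)%N (leq_subr t (nsteps m)) => [_|k IH kn].
  by rewrite subn0 PT !mxE/= !mulr0n.
have sn : (nsteps m - k.+1 < nsteps m)%N by rewrite ltn_subrL (leq_trans _ kn).
have [-> _ _] := back _ sn.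
rewrite !(mxE, sum_ord2, sum_ord1)/= !(mulr1n, mulr0n).
have := IH (ltnW kn); rewrite -subSn// subSS => ->.
by ring.
Qed.

(** The coefficients read their sequences only at [t.+1], so constant sequences allow one step to be
    written from the triple of the next date alone. *)
Definition backward_step (t : nat) (Pbe : 'M[R]_2 * 'cV[R]_2 * R) : 'M[R]_2 * 'cV[R]_2 * R :=
  let: (P', b', e') := Pbe in
  let g := coef_g m (fun=> P') t in
  let k := coef_k m (fun=> P') t in
  let f := coef_f m (fun=> P') (fun=> b') t in
  (P' - (kappa m t * dt m) *: (diag2 1 0 *m P' + P' *m diag2 1 0)
      + ((kappa m t) ^+ 2 * (dt m) ^+ 2) *: (diag2 1 0 *m P' *m diag2 1 0)
      + dt m *: (diag2 0 (beta m t) - (vol_ratio m t * g) *: (k *m k^T)),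
   b' - dt m *: ((2 * vol_ratio m t * g * f) *: k + kappa m t *: (diag2 1 0 *m b')
      - (2 * alpha m t) *:
        ((diag2 1 1 - (kappa m t * dt m) *: diag2 1 0) *m P' *m vec2 1 0)),
   e' + ((sigma m t) ^+ 2 + (alpha m t) ^+ 2 * (dt m) ^+ 2)
        * scal ((vec2 1 0)^T *m P' *m vec2 1 0)
      + (alpha m t * scal (b'^T *m vec2 1 0) - vol_ratio m t * g * f ^+ 2) * dt m).

Lemma backward_iteration_exists : exists (P : nat -> 'M[R]_2) (b : nat -> 'cV[R]_2) (e : nat -> R),
  terminal_conditions m P b e /\ backward_iteration m P b e.
Proof.
pose fix Pbe i := match i with
  | 0 => (diag2 0 (betaT m), 0, 0)
  | j.+1 => backward_step (nsteps m - j.+1) (Pbe j)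
  end.
exists (fun t => (Pbe (nsteps m - t)%N).1.1), (fun t => (Pbe (nsteps m - t)%N).1.2),
  (fun t => (Pbe (nsteps m - t)%N).2).
split; first by rewrite /terminal_conditions subnn.
move=> t tn; rewrite /coef_k /coef_f /coef_g.
rewrite (_ : (nsteps m - t)%N = (nsteps m - t.+1).+1); last by rewrite -subSn.
rewrite [Pbe _.+1]/= -subSn// subSS subKn ?(ltnW tn)//.
by case: (Pbe _) => [[P' b'] e']; split.
Qed.

End algebra.

(** * Integrals over increasing sequences of events *)

Section exhaustion.
Context d (T : measurableType d) (R : realType) (mu : {measure set T -> \bar R}).

Lemma nondecreasing_set_cvg_integral (G : (set T)^nat) (f : T -> \bar R) :
  nondecreasing_seq G -> (forall i, measurable (G i)) ->
  mu.-integrable (\bigcup_i G i) f ->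
  (\int[mu]_(x in G i) f x)%E @[i --> \oo] --> (\int[mu]_(x in \bigcup_i G i) f x)%E.
Proof.
move=> ndG mG intf.
have mU : measurable (\bigcup_i G i) by exact: bigcupT_measurable.
have mf := measurable_int _ intf.
have mfi i : measurable_fun (G i) f by apply: measurable_funS mf => //; exact: bigcup_sup.
rewrite [X in _ --> X]integralE; under eq_cvg do rewrite integralE.
apply: cvgeB.
- by rewrite fin_num_adde_defl// fin_numN; exact: integrable_neg_fin_num.
- by apply: ge0_nondecreasing_set_cvg_integral => // i; exact: measurable_funepos.
- by apply: ge0_nondecreasing_set_cvg_integral => // i; exact: measurable_funeneg.
Qed.

(** The asymmetry is intended: [g] will be a sum of deviations, whose integral might be infinite, so
    it passes to the limit by monotonicity, while [f] does so by integrability. Finiteness for [g]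
    then comes out of the equality. *)
Lemma eq_integral_exhaustion (G : (set T)^nat) (g f : T -> R) :
  nondecreasing_seq G -> (forall i, measurable (G i)) ->
  measurable_fun (\bigcup_i G i) g -> (forall x, 0 <= g x) ->
  mu.-integrable (\bigcup_i G i) (EFin \o f) ->
  (forall i, \int[mu]_(x in G i) (g x)%:E = \int[mu]_(x in G i) (f x)%:E)%E ->
  (\int[mu]_(x in \bigcup_i G i) (g x)%:E = \int[mu]_(x in \bigcup_i G i) (f x)%:E)%E.
Proof.
move=> ndG mG mg g0 intf gf.
have cf := nondecreasing_set_cvg_integral ndG mG intf.
have cg : (\int[mu]_(x in G i) (g x)%:E)%E @[i --> \oo] -->
    (\int[mu]_(x in \bigcup_i G i) (g x)%:E)%E.
  apply: ge0_nondecreasing_set_cvg_integral => //.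
  - move=> i; apply/measurable_EFinP; apply: measurable_funS mg.
      exact: bigcupT_measurable.
    exact: bigcup_sup.
  - by move=> i x _; rewrite lee_fin.
move: cg; under eq_cvg do rewrite gf; move=> cg.
exact: cvg_unique cg cf.
Qed.

End exhaustion.

(** * Moments of the shocks *)

Section standard_normal_moments.
Context (R : realType) d (Omega : measurableType d) (Pr : probability Omega R).
Variable Z : {RV Pr >-> R}.
Hypothesis nZ : standard_normal Z.

(* [Z] with its codomain seen as the carrier type of [normal_prob] *)
Let mZ : measurable_fun setT (Z : Omega -> measurableTypeR R).
Proof. exact: (@measurable_funPT _ _ _ _ Z). Qed.

Let Z' : {mfun Omega >-> measurableTypeR R} :=
  MeasurableFun.Pack (MeasurableFun.Class (isMeasurableFun.Build _ _ _ _ _ mZ)).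

Let integral_Z' (h : measurableTypeR R -> \bar R) :
  (\int[distribution Pr Z']_x h x = \int[normal_prob 0 1]_x h x)%E.
Proof. by apply: eq_measure_integral => B mB _; exact: nZ. Qed.

Lemma standard_normal_moment2 :
  Pr.-integrable setT (fun w => (Z w ^+ 2)%:E) /\ (\int[Pr]_w (Z w ^+ 2)%:E = 1)%E.
Proof.
have E : (\int[Pr]_w (Z w ^+ 2)%:E = 1)%E.
  rewrite -[RHS](@normal_moment2 R) -integral_Z' ge0_integral_distribution//.
  - by apply/measurable_EFinP; exact: measurable_funX.
  - by move=> x; rewrite lee_fin sqr_ge0.
split => //; apply/integrableP; split.
  by apply/measurable_EFinP; exact: measurable_funX.
under eq_integral do rewrite gee0_abs ?lee_fin ?sqr_ge0//.
by rewrite E ltry.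
Qed.

Lemma standard_normal_mean :
  Pr.-integrable setT (fun w => (Z w)%:E) /\ (\int[Pr]_w (Z w)%:E = 0)%E.
Proof.
have I : Pr.-integrable setT (fun w => (Z w)%:E).
  have [i2 _] := standard_normal_moment2.
  have i1 : Pr.-integrable setT (fun=> 1%:E) by exact: finite_measure_integrable_cst.
  have := integrableD measurableT i1 i2.
  apply: le_integrable => //; first exact/measurable_EFinP.
  move=> w _; rewrite /= lee_fin [leRHS]ger0_norm ?addr_ge0 ?sqr_ge0//.
  by rewrite ler_norml; apply/andP; split; nra.
split => //.
rewrite -[RHS](@normal_mean R) -integral_Z' integral_distribution//.
Qed.

End standard_normal_moments.

(** * Functions of the past and their orthogonality to the next shock *)

Section adapted.
Context (R : realType) (m : market R) d (Omega : measurableType d)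
  (Pr : probability Omega R) (z : nat -> {RV Pr >-> R}).

Definition past_gen t : set_system Omega :=
  [set A | exists s, (s < t)%N /\ exists2 B : set R, measurable B & A = z s @^-1` B].

(** The sample space equipped with the past as its sigma-algebra: dependence on the past alone
    becomes ordinary measurability, with all its closure lemmas. *)
Definition past_type t := g_sigma_algebraType (past_gen t).

Definition past_fun t (f : Omega -> R) := measurable_fun (setT : set (past_type t)) f.

Lemma past_funP t f :
  past_fun t f <-> (forall B : set R, measurable B -> past z t (f @^-1` B)).
Proof.
split => [mf B mB|h _ B mB]; last by rewrite setTI; exact: h.
by have := mf measurableT B mB; rewrite setTI.
Qed.

Lemma past_fun_measurable t f : past_fun t f -> measurable_fun setT f.
Proof.
by move=> /past_funP mf _ B mB; rewrite setTI; apply: past_measurable; exact: mf.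
Qed.

Lemma past_funS s t f : (s <= t)%N -> past_fun s f -> past_fun t f.
Proof.
move=> st /past_funP mf; apply/past_funP => B mB.
by apply: (sub_past st); exact: mf.
Qed.

Lemma past_fun_shock s t : (s < t)%N -> past_fun t (z s).
Proof. by move=> st; apply/past_funP => B mB; exact: past_preimage. Qed.

Lemma pastI t A B : past z t A -> past z t B -> past z t (A `&` B).
Proof. by move=> pA pB; apply: (@measurableI _ (past_type t)). Qed.

Lemma past_le t f K : past_fun t f -> past z t [set w | f w <= K].
Proof.
move=> /past_funP mf; have := mf `]-oo, K]%classic (measurable_itv _).
by congr (past z t _); apply/seteqP; split => w /=; rewrite in_itv.
Qed.

Lemma past_fun_norm t f : past_fun t f -> past_fun t (fun w => `|f w|).
Proof. by move=> mf; apply: measurableT_comp mf. Qed.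

Lemma past_fun_indic t A : past z t A -> past_fun t (\1_A).
Proof. by move=> pA; apply: (@measurable_indic _ (past_type t)). Qed.

Hypothesis iid : iid_standard_normal m z.

(** Integrability of [f] suffices, by independence. Bounded factors serve arbitrary controls;
    integrable ones are needed along the closed loop of the feedback. *)
Lemma shock_orthogonal t (f : Omega -> R) : (t < nsteps m)%N -> past_fun t f ->
  Pr.-integrable setT (EFin \o f) ->
  Pr.-integrable setT (fun w => (f w * z t w)%:E) /\
  (\int[Pr]_w (f w * z t w)%:E = 0)%E.
Proof.
move=> tn pf intf; have [nz ind] := iid.
pose X : {mfun Omega >-> R} := MeasurableFun.Pack (MeasurableFun.Class
  (isMeasurableFun.Build _ _ _ _ _ (past_fun_measurable pf))).
have [iz z0] := standard_normal_mean (nz _ tn).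
have XZ A B : measurable A -> measurable B ->
    Pr (X @^-1` A `&` z t @^-1` B) = (Pr (X @^-1` A) * Pr (z t @^-1` B))%E.
  by move=> mA mB; apply: (past_independent ind) => //; exact: ((past_funP t f).1 pf).
have := @integrable_expectationM_indep _ _ _ _ _ _ _ _ X (z t) id id XZ.
rewrite /= z0 mule0; exact.
Qed.

Lemma shock2_orthogonal t (f : Omega -> R) : (t < nsteps m)%N -> past_fun t f ->
  Pr.-integrable setT (EFin \o f) ->
  Pr.-integrable setT (fun w => (f w * (z t w ^+ 2 - 1))%:E) /\
  (\int[Pr]_w (f w * (z t w ^+ 2 - 1))%:E = 0)%E.
Proof.
move=> tn pf intf; have [nz ind] := iid.
pose X : {mfun Omega >-> R} := MeasurableFun.Pack (MeasurableFun.Class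
  (isMeasurableFun.Build _ _ _ _ _ (past_fun_measurable pf))).
have [iz z1] := standard_normal_moment2 (nz _ tn).
have XZ A B : measurable A -> measurable B ->
    Pr (X @^-1` A `&` z t @^-1` B) = (Pr (X @^-1` A) * Pr (z t @^-1` B))%E.
  by move=> mA mB; apply: (past_independent ind) => //; exact: ((past_funP t f).1 pf).
have i1 : Pr.-integrable setT (fun=> 1%:E) by exact: finite_measure_integrable_cst.
have z0 : (\int[Pr]_w (z t w ^+ 2 - 1)%:E = 0)%E.
  have e1 : (\int[Pr]_w (fun=> 1%:E) w = 1)%E.
    by have := expectation_cst Pr 1; rewrite unlock.
  transitivity (\int[Pr]_w ((fun w => (z t w ^+ 2)%:E) \- (fun=> 1%:E)) w)%E.
    by apply: eq_integral => w _; rewrite EFinB.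
  by rewrite integralB// z1 e1 subee.
have := @integrable_expectationM_indep _ _ _ _ _ _ _ _ X (z t) id (fun x => x ^+ 2 - 1) XZ.
rewrite /= z0 mule0; apply => //.
  by apply: measurable_funB => //; exact: measurable_funX.
exact: (integrableB measurableT iz i1).
Qed.

End adapted.

(** * Cancellation of the noise when only the final sum is integrable *)

Section martingale.
Context (R : realType) (m : market R) d (Omega : measurableType d)
  (Pr : probability Omega R) (z : nat -> {RV Pr >-> R}).
Hypothesis iid : iid_standard_normal m z.

Lemma bounded_integrable (G : set Omega) (f : Omega -> R) K : measurable G ->
  measurable_fun setT f -> (forall w, G w -> `|f w| <= K) ->
  Pr.-integrable G (EFin \o f).
Proof.
move=> mG mf fK.
have iK : Pr.-integrable G (fun=> K%:E) by exact: finite_measure_integrable_cst.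
apply: le_integrable iK => //.
  by apply/measurable_EFinP; exact: measurable_funS mf.
by move=> w Gw; rewrite /= lee_fin (le_trans (fK _ Gw))// ler_norm.
Qed.

Context (t0 : nat) (D A : nat -> Omega -> R) (c : nat -> R).
Hypothesis D0 : forall k w, (t0 <= k < nsteps m)%N -> 0 <= D k w.
Hypothesis pD : forall k, (t0 <= k < nsteps m)%N -> past_fun z k (D k).
Hypothesis pA : forall k, (t0 <= k < nsteps m)%N -> past_fun z k (A k).

Definition noise k w : R := A k w * z k w + c k * (z k w ^+ 2 - 1).
Definition partial_sum k w : R := \sum_(t0 <= i < k) (D i w + noise i w).
Definition drift_from k w : R := \sum_(k <= i < nsteps m) D i w.

Lemma past_fun_noise k : (t0 <= k < nsteps m)%N -> past_fun z k.+1 (noise k).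
Proof.
move=> kn; apply: measurable_funD; apply: measurable_funM => //.
- by apply: past_funS (pA kn).
- exact: past_fun_shock.
- apply: measurable_funB => //; apply: measurable_funX; exact: past_fun_shock.
Qed.

Lemma past_fun_partial_sum k : (k <= nsteps m)%N -> past_fun z k (partial_sum k).
Proof.
rewrite /partial_sum; elim: k => [|k IH] kn.
  by under eq_fun do rewrite big_geq//; exact: measurable_cst.
have [tk|kt] := leqP t0 k; last first.
  by under eq_fun do rewrite big_geq//; exact: measurable_cst.
have tkn : (t0 <= k < nsteps m)%N by rewrite tk.
under eq_fun do rewrite big_nat_recr//=.
apply: measurable_funD; first by apply: (past_funS (leqnSn k)); apply: IH; exact: ltnW.
apply: measurable_funD; first by apply: (past_funS (leqnSn k)); exact: pD.
exact: past_fun_noise.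
Qed.

Lemma measurable_drift_from k : (t0 <= k)%N -> measurable_fun setT (drift_from k).
Proof.
move=> tk; suff h j : (j <= nsteps m)%N ->
    measurable_fun setT (fun w => \sum_(k <= i < j) D i w) by exact: h.
elim: j => [|j IH] jn.
  by under eq_fun do rewrite big_geq//; exact: measurable_cst.
have [kj|jk] := leqP k j; last first.
  by under eq_fun do rewrite big_geq//; exact: measurable_cst.
under eq_fun do rewrite big_nat_recr//=.
apply: measurable_funD; first by apply: IH; exact: ltnW.
apply: (@past_fun_measurable _ _ _ _ z j); apply: pD.
by rewrite jn (leq_trans tk).
Qed.

Lemma drift_from_ge0 k w : (t0 <= k)%N -> 0 <= drift_from k w.
Proof.
move=> tk; rewrite /drift_from big_nat_cond sumr_ge0// => i.
by rewrite andbT => /andP[ki iN]; apply: D0; rewrite iN (leq_trans tk).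
Qed.

Lemma integral_noise k (G : set Omega) K : (t0 <= k < nsteps m)%N -> past z k G ->
  (forall w, G w -> `|A k w| <= K) ->
  Pr.-integrable G (EFin \o noise k) /\ (\int[Pr]_(w in G) (noise k w)%:E = 0)%E.
Proof.
move=> tk pG AK; have /andP[_ kn] := tk.
have mG : measurable G := past_measurable pG.
have E : (EFin \o noise k) \_ G = (fun w => ((\1_G w * A k w) * z k w)%:E +
     (c k)%:E * (\1_G w * (z k w ^+ 2 - 1))%:E)%E.
  apply/funext => w; rewrite patchE /= indicE; case: ifPn => _.
    by rewrite !mul1r -EFinM -EFinD.
  by rewrite !mul0r -EFinM mulr0 addr0.
have p1 : past_fun z k (\1_G : Omega -> R) := past_fun_indic pG.
have [i1 e1] : Pr.-integrable setT (fun w => ((\1_G w * A k w) * z k w)%:E) /\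
    (\int[Pr]_w ((\1_G w * A k w) * z k w)%:E = 0)%E.
  apply: (shock_orthogonal iid) => //.
    by apply: measurable_funM => //; exact: pA.
  (* The product vanishes off [G], and [K] may be negative when [G] is empty, hence the maximum with
     0. *)
  apply: (@bounded_integrable _ _ (Num.max K 0)) => //.
    by apply: measurable_funM => //; exact: past_fun_measurable (pA tk).
  move=> w _; rewrite indicE; case: (boolP (w \in G)) => [|_].
    by rewrite inE mul1r => /AK ?; rewrite le_max; apply/orP; left.
  by rewrite mul0r normr0 le_max lexx orbT.
have [i2 e2] : Pr.-integrable setT (fun w => (\1_G w * (z k w ^+ 2 - 1))%:E) /\
    (\int[Pr]_w (\1_G w * (z k w ^+ 2 - 1))%:E = 0)%E.
  apply: (shock2_orthogonal iid) => //; exact: integrable_indic.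
have i3 := integrableZl measurableT (c k) i2.
split; first by apply/(integrable_mkcond _ mG); rewrite E; exact: integrableD.
rewrite integral_mkcond E integralD// e1 integralZl// e2 mule0 adde0 //.
Qed.

Hypothesis iL : Pr.-integrable setT (EFin \o partial_sum (nsteps m)).

(** A substitute for conditioning on the past of [k]. The bound on [partial_sum k] makes the
    right-hand integrand integrable on [G]; the left-hand one is nonnegative. Passing from [k.+1] to
    [k] requires events on which [partial_sum k.+1] is bounded too. *)
Lemma integral_drift_from k G K : (t0 <= k <= nsteps m)%N -> past z k G ->
  (forall w, G w -> `|partial_sum k w| <= K) ->
  (\int[Pr]_(w in G) (drift_from k w)%:E =
   \int[Pr]_(w in G) (partial_sum (nsteps m) w - partial_sum k w)%:E)%E.
Proof.
move=> /andP[]; set N := nsteps m => + kN; rewrite -(subKn kN).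
elim: (N - k)%N (leq_subr k N) G K => {k kN} [_|j IH jN] G K.
  rewrite subn0 => tN pG _; apply: eq_integral => w _.
  by rewrite subrr /drift_from big_geq.
set k := (N - j.+1)%N => tk.
have kN : (k < N)%N by rewrite ltn_subrL (leq_trans _ jN).
have Ek : (N - j = k.+1)%N by rewrite /k -subSn.
have tkN : (t0 <= k < N)%N by rewrite tk.
rewrite Ek in IH.
have {}IH := IH (ltnW jN) _ _ (leqW tk).
have mS i : (i <= N)%N -> measurable_fun setT (partial_sum i).
  by move=> iN; apply: past_fun_measurable (past_fun_partial_sum iN).
have iLS G' K' : measurable G' -> (forall w, G' w -> `|partial_sum k w| <= K') ->
    Pr.-integrable G' (fun w => (partial_sum N w - partial_sum k w)%:E).
  move=> mG' GK'; apply: (@integrableB _ _ _ _ _ _ (EFin \o partial_sum N)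
    (EFin \o partial_sum k)) => //.
    exact: integrableS iL.
  by apply: (@bounded_integrable _ _ K') => //; apply: mS; exact: ltnW.
have SE w : partial_sum k.+1 w = partial_sum k w + D k w + noise k w.
  by rewrite /partial_sum big_nat_recr//= addrA.
have DE w : drift_from k w = D k w + drift_from k.+1 w.
  by rewrite /drift_from big_ltn.
(* First for [A k] and [D k] bounded on the event, by truncating the shock [z k];
   then in general by truncating [A k] and [D k]. *)
have bounded G' K' : past z k G' -> (forall w, G' w -> `|partial_sum k w| <= K') ->
    (forall w, G' w -> `|A k w| <= K') -> (forall w, G' w -> `|D k w| <= K') ->
    (\int[Pr]_(w in G') (drift_from k w)%:E =
     \int[Pr]_(w in G') (partial_sum N w - partial_sum k w)%:E)%E.
  move=> pG' SK' AK' DK'; have mG' := past_measurable pG'.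
  have [iM M0] := integral_noise tkN pG' AK'.
  have mD : measurable_fun setT (D k) by apply: past_fun_measurable (pD tkN).
  have iD : Pr.-integrable G' (EFin \o D k) by exact: bounded_integrable DK'.
  have iL1 : Pr.-integrable G' (fun w => (partial_sum N w - partial_sum k.+1 w)%:E).
    have := integrableB mG' (integrableB mG' (iLS _ _ mG' SK') iD) iM.
    apply: eq_integrable => // w _ /=; rewrite -!EFinB; congr EFin.
    by rewrite SE; ring.
  pose Gj (i : nat) := G' `&` [set w | `|z k w| <= i%:R].
  have UG : \bigcup_i Gj i = G'.
    apply/seteqP; split => [w [i _ []//]|w Gw].
    have [i zi] : exists i : nat, `|z k w| <= i%:R.
      by exists (Num.truncn `|z k w|).+1; rewrite ltW// truncnS_gt.
    by exists i.
  have pGj i : past z k.+1 (Gj i).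
    apply: pastI; first exact: (sub_past (leqnSn k)).
    by apply: past_le; apply: past_fun_norm; exact: past_fun_shock.
  have key : (\int[Pr]_(w in G') (drift_from k.+1 w)%:E =
     \int[Pr]_(w in G') (partial_sum N w - partial_sum k.+1 w)%:E)%E.
    rewrite -UG; apply: eq_integral_exhaustion.
    - move=> i i' ii'; apply/subsetPset => w [Gw zw]; split => //=.
      by rewrite (le_trans zw)// ler_nat.
    - by move=> i; exact: past_measurable (pGj i).
    - apply: measurable_funTS; apply: measurable_drift_from; exact: leqW.
    - by move=> w; apply: drift_from_ge0; exact: leqW.
    - by rewrite UG.
    (* The bound adds those of [partial_sum k], of [D k], of [A k * z k] and of the centred square,
       all on the truncated event. *)
    - move=> i; apply: (IH _ (K' + K' + (K' * i%:R + `|c k| * (i%:R ^+ 2 + 1))) (pGj i)).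
      move=> w [Gw /= zw]; rewrite SE.
      have K0 : 0 <= K' := le_trans (normr_ge0 _) (AK' _ Gw).
      apply: (le_trans (ler_normD _ _)); apply: lerD.
        apply: (le_trans (ler_normD _ _)); apply: lerD; [exact: SK'|exact: DK'].
      apply: (le_trans (ler_normD _ _)); apply: lerD; rewrite normrM.
        by apply: ler_pM => //; exact: AK'.
      apply: ler_wpM2l => //; apply: (le_trans (ler_normB _ _)).
      by rewrite normr1 normrX lerD2r lerXn2r// nnegrE.
  under eq_integral do rewrite DE EFinD.
  rewrite ge0_integralD//; last 4 first.
  - by move=> w _; rewrite lee_fin D0.
  - by apply/measurable_EFinP; exact: measurable_funTS.
  - by move=> w _; rewrite lee_fin drift_from_ge0// leqW.
  - by apply/measurable_EFinP; apply: measurable_funTS; apply: measurable_drift_from; exact: leqW.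
  (* Adding [D k] to the increment after [k.+1] gives the increment after [k] minus the noise, which
     integrates to 0 over [G']. *)
  rewrite key -integralD//.
    transitivity (\int[Pr]_(w in G') ((partial_sum N w - partial_sum k w)%:E - (noise k w)%:E))%E.
    by apply: eq_integral => w _; rewrite -EFinD -EFinB SE; congr EFin; ring.
  by rewrite (integralB mG' (iLS _ _ mG' SK') iM) M0 sube0.
move=> pG SK.
pose Gj (i : nat) := G `&` ([set w | `|A k w| <= i%:R] `&` [set w | `|D k w| <= i%:R]).
have UG : \bigcup_i Gj i = G.
  apply/seteqP; split => [w [i _ []//]|w Gw].
  pose i := maxn (Num.truncn `|A k w|).+1 (Num.truncn `|D k w|).+1.
  exists i => //; split => //; split => /=.
    by rewrite (le_trans (ltW (truncnS_gt _)))// ler_nat leq_maxl.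
  by rewrite (le_trans (ltW (truncnS_gt _)))// ler_nat leq_maxr.
have pGj i : past z k (Gj i).
  by apply: pastI => //; apply: pastI; apply: past_le; apply: past_fun_norm; [exact: pA|exact: pD].
have iLG := iLS _ _ (past_measurable pG) SK.
rewrite -UG; apply: eq_integral_exhaustion.
- move=> i i' ii'; apply/subsetPset => w [Gw [Aw Dw]]; split => //; split => /=.
    by rewrite (le_trans Aw)// ler_nat.
  by rewrite (le_trans Dw)// ler_nat.
- by move=> i; exact: past_measurable (pGj i).
- by apply: measurable_funTS; exact: measurable_drift_from.
- by move=> w; exact: drift_from_ge0.
- by rewrite UG.
- move=> i; apply: (bounded _ (Num.max K i%:R)) => //.
  + by move=> w [Gw _]; rewrite le_max SK.
  + by move=> w [_ [Aw _]]; rewrite le_max Aw orbT.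
  + by move=> w [_ [_ Dw]]; rewrite le_max Dw orbT.
Qed.

End martingale.

(** * Cost of a control and its decomposition *)

Section control.
Context (R : realType) (m : market R) d (Omega : measurableType d)
  (Pr : probability Omega R) (z : nat -> {RV Pr >-> R}).
Hypothesis dt0 : 0 < dt m.
Hypothesis iid : iid_standard_normal m z.
Context (P : nat -> 'M[R]_2) (b : nat -> 'cV[R]_2) (e : nat -> R).
Hypothesis termPbe : terminal_conditions m P b e.
Hypothesis backPbe : backward_iteration m P b e.

Let sym t : (t <= nsteps m)%N -> P t 0 1 = P t 1 0.
Proof. exact: (backward_iteration_sym termPbe backPbe). Qed.

Lemma stateS t X u k w : (t <= k)%N ->
  state m z t X u k.+1 w = step m k (state m z t X u k w) (u k w) (z k w).
Proof. by move=> tk; rewrite /state subSn//= subnKC. Qed.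

Lemma state0 t X u w : state m z t X u t w = X.
Proof. by rewrite /state subnn. Qed.

Lemma past_fun_step k (X : Omega -> 'cV[R]_2) (v : Omega -> R) (i : 'I_2) :
  (forall i, past_fun z k (fun w => X w i 0)) -> past_fun z k v ->
  past_fun z k.+1 (fun w => step m k (X w) (v w) (z k w) i 0).
Proof.
move=> pX pv; have pz : past_fun z k.+1 (z k) by exact: past_fun_shock.
have pX' j : past_fun z k.+1 (fun w => X w j 0) by apply: (past_funS (leqnSn k)).
have pv' : past_fun z k.+1 v by apply: (past_funS (leqnSn k)).
have [-> | ->] : i = 0 \/ i = 1.
  by case: i => [[|[|//]] Hi]; [left|right]; exact: val_inj.
- under eq_fun do rewrite stepE0.
  apply: measurable_funD; last first.
    by apply: measurable_funD => //; exact: measurable_funM.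
  apply: measurable_funD; apply: measurable_funM => //; first exact: pX'.
  by apply: measurable_funM => //; exact: measurable_funM.
- under eq_fun do rewrite stepE1.
  apply: measurable_funB; first exact: pX'.
  by apply: measurable_funM => //; exact: measurable_funM.
Qed.

Lemma adapted_past_fun t u k : adapted_from m z t u -> (t <= k < nsteps m)%N ->
  past_fun z k (u k).
Proof. by move=> au tk; apply/past_funP; exact: au. Qed.

Lemma past_fun_state t X u k i : adapted_from m z t u -> (t <= k <= nsteps m)%N ->
  past_fun z k (fun w => state m z t X u k w i 0).
Proof.
move=> au; elim: k i => [|k IH] i /andP[tk kn].
  by move: tk; rewrite leqn0 => /eqP ->; under eq_fun do rewrite state0; exact: measurable_cst.
move: tk; rewrite leq_eqVlt => /orP[/eqP <-|tk].
  by under eq_fun do rewrite state0; exact: measurable_cst.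
rewrite ltnS in tk; under eq_fun do rewrite stateS//.
apply: past_fun_step => [j|].
  by apply: IH; rewrite tk ltnW.
by apply: (adapted_past_fun au); rewrite tk.
Qed.

Definition deviation t X u k w : R := vol_ratio m k * coef_g m P k * dt m *
  (u k w - feedback m P b k (state m z t X u k w)) ^+ 2.

Definition shock_loading t X u k w : R :=
  shock_coef m P b k (state m z t X u k w) (u k w).

(** Since [dt m] is positive, this is strict convexity in the action of the Bellman parabolas at all
    dates from [t] on. *)
Definition convex_from t := forall k, (t <= k < nsteps m)%N ->
  0 < vol_ratio m k * coef_g m P k.

Let gneq0 t k : convex_from t -> (t <= k < nsteps m)%N -> coef_g m P k != 0.
Proof. by move=> h /h; apply: contraTneq => ->; rewrite mulr0 ltxx. Qed.

Lemma total_costE t X u w : (t <= nsteps m)%N -> convex_from t ->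
  total_cost m z t X u w = quadratic_form P b e t X +
    partial_sum z t (deviation t X u) (shock_loading t X u) (shock_coef2 m P) (nsteps m) w.
Proof.
move=> tn pos; rewrite /total_cost.
have -> : terminal_cost m (state m z t X u (nsteps m) w) =
    quadratic_form P b e (nsteps m) (state m z t X u (nsteps m) w).
  have [PT bT eT] := termPbe.
  by rewrite quadratic_formE PT bT eT /terminal_cost !mxE/= !(mulr1n, mulr0n); ring.
(* Stopping at an intermediate date [k], with the quadratic form in place of the terminal cost,
   makes [complete_square] telescope. *)
suff h k : (t <= k <= nsteps m)%N ->
    \sum_(t <= tau < k) stage_cost m tau (state m z t X u tau w) (u tau w) * dt m
    + quadratic_form P b e k (state m z t X u k w) = quadratic_form P b e t X +
    partial_sum z t (deviation t X u) (shock_loading t X u) (shock_coef2 m P) k w.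
  by apply: h; rewrite tn leqnn.
elim: k => [|k IH] /andP[tk kn].
  by move: tk; rewrite leqn0 => /eqP ->; rewrite /partial_sum !big_geq// state0 addr0 add0r.
move: tk; rewrite leq_eqVlt => /orP[/eqP <-|tk].
  by rewrite /partial_sum !big_geq// state0 addr0 add0r.
rewrite ltnS in tk.
have tkn : (t <= k < nsteps m)%N by rewrite tk.
have := IH; rewrite tk ltnW// => /(_ isT) {}IH.
rewrite /partial_sum !big_nat_recr//= [RHS]addrA.
move: IH; rewrite /partial_sum => <-.
rewrite stateS// quadratic_form_step.
have := complete_square (state m z t X u k w) (u k w) backPbe kn (sym kn) (gneq0 pos tkn).
rewrite /noise /deviation /shock_loading; lra.
Qed.

Let past_fun_poly1 k (X : Omega -> 'cV[R]_2) (a0 a1 a2 : R) :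
  (forall i, past_fun z k (fun w => X w i 0)) ->
  past_fun z k (fun w => a0 * X w 0 0 + a1 * X w 1 0 + a2).
Proof.
move=> pX; apply: measurable_funD => //.
by apply: measurable_funD; apply: measurable_funM => //; exact: pX.
Qed.

Lemma past_fun_feedback k (X : Omega -> 'cV[R]_2) :
  (forall i, past_fun z k (fun w => X w i 0)) ->
  past_fun z k (fun w => feedback m P b k (X w)).
Proof. by move=> pX; under eq_fun do rewrite feedbackE; exact: past_fun_poly1. Qed.

Lemma past_fun_deviation t X u k : adapted_from m z t u -> (t <= k < nsteps m)%N ->
  past_fun z k (deviation t X u k).
Proof.
move=> au tkn; have /andP[tk kn] := tkn.
apply: measurable_funM => //; apply: measurable_funX.
apply: measurable_funB; first exact: adapted_past_fun au _.
apply: (@past_fun_feedback k (state m z t X u k)) => i.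
by apply: (past_fun_state X i au); rewrite tk ltnW.
Qed.

Lemma past_fun_shock_loading t X u k : adapted_from m z t u -> (t <= k < nsteps m)%N ->
  past_fun z k (shock_loading t X u k).
Proof.
move=> au tkn; have /andP[tk kn] := tkn.
have pu := adapted_past_fun au tkn.
have pX i : past_fun z k (fun w => state m z t X u k w i 0).
  by apply: (past_fun_state X i au); rewrite tk ltnW.
rewrite /shock_loading /shock_coef; under eq_fun do rewrite stepE0 stepE1.
apply: measurable_funM => //; apply: measurable_funD => //.
apply: measurable_funD; apply: measurable_funM => //.
  apply: measurable_funD => //; apply: measurable_funD; apply: measurable_funM => //.
    exact: pX.
  by apply: measurable_funM => //; exact: measurable_funM.
apply: measurable_funB; first exact: pX.
by apply: measurable_funM => //; exact: measurable_funM.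
Qed.

Lemma deviation_ge0 t X u k w : convex_from t -> (t <= k < nsteps m)%N ->
  0 <= deviation t X u k w.
Proof.
by move=> pos tk; rewrite mulr_ge0 ?sqr_ge0// mulr_ge0// ltW//; exact: pos.
Qed.

Lemma expectation_total_cost t X u : (t <= nsteps m)%N -> convex_from t ->
  admissible m z t X u ->
  ('E_Pr[total_cost m z t X u] = (quadratic_form P b e t X)%:E
    + \int[Pr]_w (drift_from m (deviation t X u) t w)%:E)%E.
Proof.
move=> tn pos [au iJ]; rewrite unlock.
set q := quadratic_form _ _ _ _ _.
pose S := partial_sum z t (deviation t X u) (shock_loading t X u) (shock_coef2 m P) (nsteps m).
have JE w : total_cost m z t X u w = q + S w by exact: total_costE.
have iq : Pr.-integrable setT (fun=> q%:E) by exact: finite_measure_integrable_cst.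
have iS : Pr.-integrable setT (EFin \o S).
  have := integrableB measurableT iJ iq.
  apply: eq_integrable => // w _ /=; rewrite JE -EFinB; congr EFin.
  by rewrite addrC addKr.
have pT : past z t setT by exact: (@measurableT _ (past_type z t)).
have S0 w : partial_sum z t (deviation t X u) (shock_loading t X u) (shock_coef2 m P) t w = 0.
  by rewrite /partial_sum big_geq.
(* At the initial date the partial sum is empty, so the whole space is a valid event, with bound
   0. *)
rewrite (@integral_drift_from _ _ _ _ _ _ iid t (deviation t X u) (shock_loading t X u)
  (shock_coef2 m P) _ _ _ iS t setT 0) ?leqnn//; first last.
- by move=> w _; rewrite S0 normr0.
- by move=> k tk; exact: past_fun_shock_loading.
- by move=> k tk; exact: past_fun_deviation.
- by move=> k w tk; exact: deviation_ge0.
under [in RHS]eq_integral do rewrite S0 subr0.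
transitivity (\int[Pr]_w (q%:E + (S w)%:E))%E.
  by apply: eq_integral => w _; rewrite /= JE EFinD.
rewrite integralD//; congr (_ + _)%E.
by have := expectation_cst Pr q; rewrite unlock.
Qed.

(** * The feedback control: admissibility and optimality *)

Fixpoint closed_loop t X (i : nat) (w : Omega) : 'cV[R]_2 :=
  match i with
  | 0 => X
  | j.+1 => step m (t + j) (closed_loop t X j w)
      (feedback m P b (t + j) (closed_loop t X j w)) (z (t + j)%N w)
  end.

Definition feedback_control t X k w := feedback m P b k (closed_loop t X (k - t) w).

(** A control is a process given in advance, while the feedback reads the state which that control
    drives. Running [closed_loop] first breaks the circle, and this lemma identifies the two
    trajectories. *)
Lemma state_feedback_control t X k w : (t <= k)%N ->
  state m z t X (feedback_control t X) k w = closed_loop t X (k - t) w.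
Proof.
move=> _; rewrite /state; elim: (k - t)%N => //= i ->.
by rewrite /feedback_control addKn.
Qed.

Lemma feedback_controlE t X k w : (t <= k)%N ->
  feedback_control t X k w =
  feedback m P b k (state m z t X (feedback_control t X) k w).
Proof. by move=> tk; rewrite state_feedback_control. Qed.

Lemma past_fun_closed_loop t X i (j : 'I_2) :
  past_fun z (t + i) (fun w => closed_loop t X i w j 0).
Proof.
elim: i j => [|i IH] j; first exact: measurable_cst.
rewrite addnS /=; apply: past_fun_step => //.
exact: past_fun_feedback.
Qed.

Lemma adapted_feedback_control t X : adapted_from m z t (feedback_control t X).
Proof.
move=> k /andP[tk kn]; apply/past_funP.
rewrite -(subnKC tk); apply: (@past_fun_feedback _ (closed_loop t X _)) => j.
by rewrite addKn; exact: past_fun_closed_loop.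
Qed.

Let integrable_poly1 (X : Omega -> 'cV[R]_2) (a0 a1 a2 : R) :
  (forall i, Pr.-integrable setT (fun w => (X w i 0)%:E)) ->
  Pr.-integrable setT (fun w => (a0 * X w 0 0 + a1 * X w 1 0 + a2)%:E).
Proof.
move=> iX; have i2 : Pr.-integrable setT (fun=> a2%:E) by exact: finite_measure_integrable_cst.
have i0 := integrableZl measurableT a0 (iX 0).
have i1 := integrableZl measurableT a1 (iX 1).
exact: (integrableD measurableT (integrableD measurableT i0 i1) i2).
Qed.

(** The feedback is affine, so the next state is affine in the current one and the shock, and first
    moments propagate. They suffice: deviations vanish on the closed loop, and a shock is
    independent of the factor it multiplies. *)
Lemma integrable_closed_loop t X i (j : 'I_2) : (t + i <= nsteps m)%N ->
  Pr.-integrable setT (fun w => (closed_loop t X i w j 0)%:E).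
Proof.
elim: i j => [|i IH] j tin; first exact: finite_measure_integrable_cst.
have tn : (t + i < nsteps m)%N by rewrite -addnS.
have iX j' : Pr.-integrable setT (fun w => (closed_loop t X i w j' 0)%:E).
  by apply: IH; exact: ltnW.
have [nz _] := iid; have [iz _] := standard_normal_mean (nz _ tn).
have [-> | ->] : j = 0 \/ j = 1.
  by case: (j) => [[|[|//]] Hi]; [left|right]; exact: val_inj.
- under eq_fun do rewrite /= stepE0 feedbackE.
  set k := (t + i)%N; set v := vol_ratio m k; set k0 := coef_k _ _ _ 0 0.
  set k1 := coef_k _ _ _ 1 0; set f := coef_f _ _ _ _.
  have i1 := integrable_poly1 (1 - kappa m k * dt m + v * k0 * dt m * (Q0 m * mu m k))
    (v * k1 * dt m * (Q0 m * mu m k)) (v * f * dt m * (Q0 m * mu m k) + alpha m k * dt m) iX.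
  have := integrableD measurableT i1 (integrableZl measurableT (sigma m k) iz).
  by apply: eq_integrable => // w _ /=; rewrite -EFinM -EFinD; congr EFin; ring.
- under eq_fun do rewrite /= stepE1 feedbackE.
  set k := (t + i)%N; set v := vol_ratio m k; set k0 := coef_k _ _ _ 0 0.
  set k1 := coef_k _ _ _ 1 0; set f := coef_f _ _ _ _.
  have := integrable_poly1 (- (v * k0 * dt m)) (1 - v * k1 * dt m) (- (v * f * dt m)) iX.
  by apply: eq_integrable => // w _ /=; congr EFin; ring.
Qed.

Lemma deviation_feedback_control t X k w : (t <= k)%N ->
  deviation t X (feedback_control t X) k w = 0.
Proof.
by move=> tk; rewrite /deviation -feedback_controlE// subrr expr0n/= mulr0.
Qed.

Lemma integrable_feedback_noise t X k : (t <= k < nsteps m)%N ->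
  Pr.-integrable setT (EFin \o
    noise z (shock_loading t X (feedback_control t X)) (shock_coef2 m P) k).
Proof.
move=> tkn; have /andP[tk kn] := tkn.
have iX i : Pr.-integrable setT (fun w => (state m z t X (feedback_control t X) k w i 0)%:E).
  under eq_fun do rewrite state_feedback_control//.
  by apply: integrable_closed_loop; rewrite subnKC// ltnW.
have iA : Pr.-integrable setT (EFin \o shock_loading t X (feedback_control t X) k).
  rewrite /shock_loading /shock_coef.
  set p00 := P k.+1 0 0; set p01 := P _ 0 1 + _; set v := vol_ratio m k.
  set k0 := coef_k m P k 0 0; set k1 := coef_k m P k 1 0; set f := coef_f m P b k.
  have := integrable_poly1
    (sigma m k * (2 * p00 * (1 - kappa m k * dt m + v * k0 * dt m * (Q0 m * mu m k))
                  - p01 * v * k0 * dt m))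
    (sigma m k * (2 * p00 * (v * k1 * dt m * (Q0 m * mu m k)) + p01 * (1 - v * k1 * dt m)))
    (sigma m k * (2 * p00 * (v * f * dt m * (Q0 m * mu m k) + alpha m k * dt m)
                  - p01 * v * f * dt m + b k.+1 0 0)) iX.
  apply: eq_integrable => // w _ /=; congr EFin; rewrite stepE0 stepE1.
  rewrite feedback_controlE// feedbackE -/v -/k0 -/k1 -/f; ring.
have pA := past_fun_shock_loading X (adapted_feedback_control (t:=t) X) tkn.
have [i1 _] := shock_orthogonal iid kn pA iA.
set c := shock_coef2 m P.
have ic : Pr.-integrable setT (EFin \o cst (c k)) by exact: finite_measure_integrable_cst.
have [i2 _] := shock2_orthogonal iid kn (measurable_cst _ : past_fun z k (cst (c k))) ic.
exact: (integrableD measurableT i1 i2).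
Qed.

Lemma admissible_feedback_control t X : (t <= nsteps m)%N -> convex_from t ->
  admissible m z t X (feedback_control t X).
Proof.
move=> tn pos; split; first exact: adapted_feedback_control.
under eq_fun do rewrite total_costE//.
have iq : Pr.-integrable setT (fun=> (quadratic_form P b e t X)%:E).
  exact: finite_measure_integrable_cst.
suff h k : (k <= nsteps m)%N -> Pr.-integrable setT (fun w => (partial_sum z t
    (deviation t X (feedback_control t X)) (shock_loading t X (feedback_control t X))
    (shock_coef2 m P) k w)%:E).
  by have := integrableD measurableT iq (h _ (leqnn _)).
rewrite /partial_sum; elim: k => [|k IH] kn.
  by under eq_fun do rewrite big_geq//; exact: integrable0.
have [tk|kt] := leqP t k; last by under eq_fun do rewrite big_geq//; exact: integrable0.
under eq_fun do rewrite big_nat_recr//= deviation_feedback_control// add0r.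
have tkn : (t <= k < nsteps m)%N by rewrite tk.
exact: (integrableD measurableT (IH (ltnW kn)) (integrable_feedback_noise X tkn)).
Qed.

Lemma integral_drift_from_ge0 t X u : convex_from t ->
  (0 <= \int[Pr]_w (drift_from m (deviation t X u) t w)%:E)%E.
Proof.
move=> pos; apply: integral_ge0 => w _; rewrite lee_fin.
by apply: (@drift_from_ge0 _ _ _ _ t) => // k w' tk; exact: deviation_ge0.
Qed.

Lemma expectation_feedback_control t X : (t <= nsteps m)%N -> convex_from t ->
  ('E_Pr[total_cost m z t X (feedback_control t X)] = (quadratic_form P b e t X)%:E)%E.
Proof.
move=> tn pos; rewrite expectation_total_cost//; last exact: admissible_feedback_control.
rewrite integral0_eq ?adde0// => w _; congr EFin.
rewrite /drift_from big_nat_cond big1// => k /andP[/andP[tk _] _].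
exact: deviation_feedback_control.
Qed.

Lemma value_quadratic t X : (t <= nsteps m)%N -> convex_from t ->
  value m z t X = (quadratic_form P b e t X)%:E.
Proof.
move=> tn pos; apply/eqP; rewrite eq_le; apply/andP; split.
  rewrite -expectation_feedback_control//; apply: ereal_inf_lbound.
  by exists (feedback_control t X) => //; exact: admissible_feedback_control.
apply: le_ereal_inf_tmp => _ [u au <-].
by rewrite expectation_total_cost// leeDl// integral_drift_from_ge0.
Qed.

Lemma optimal_feedback_control t X : (t <= nsteps m)%N -> convex_from t ->
  optimal m z t X (feedback_control t X).
Proof.
move=> tn pos; split; first exact: admissible_feedback_control.
by rewrite expectation_feedback_control// value_quadratic.
Qed.

(** The excess of the expected cost over the value is the integral of a nonnegative drift. It
    vanishes exactly when almost every deviation does, that is, as [a g dt] is positive, when the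
    action is the feedback. *)
Lemma optimalP t X u : (t <= nsteps m)%N -> convex_from t -> admissible m z t X u ->
  (optimal m z t X u <-> forall tau, (t <= tau < nsteps m)%N ->
    {ae Pr, forall w, u tau w = feedback m P b tau (state m z t X u tau w)}).
Proof.
move=> tn pos adm; have [au _] := adm.
have pD k : (t <= k < nsteps m)%N -> past_fun z k (deviation t X u k).
  by move=> tk; exact: past_fun_deviation.
have D0 k w : (t <= k < nsteps m)%N -> 0 <= deviation t X u k w.
  by move=> tk; exact: deviation_ge0.
have md : measurable_fun setT (EFin \o drift_from m (deviation t X u) t).
  by apply/measurable_EFinP; exact: (measurable_drift_from pD (leqnn t)).
have d0 w : 0 <= drift_from m (deviation t X u) t w.
  exact: (drift_from_ge0 D0 w (leqnn t)).
have opt0 : optimal m z t X u <->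
    (\int[Pr]_w (drift_from m (deviation t X u) t w)%:E = 0)%E.
  rewrite /optimal expectation_total_cost// value_quadratic//; split; last first.
    by move=> ->; rewrite adde0.
  move=> [_]; have := integral_drift_from_ge0 X u pos.
  (* An integral equal to [+oo] would contradict the finite value, and [-oo] the sign. *)
  case: (\int[Pr]_w _)%E => [r _|//|//].
  by rewrite -EFinD => -[/eqP]; rewrite -subr_eq0 addrAC subrr add0r => /eqP ->.
have int0 : (\int[Pr]_w (drift_from m (deviation t X u) t w)%:E = 0)%E <->
    ae_eq Pr setT (EFin \o drift_from m (deviation t X u) t) (cst 0%E).
  rewrite -ae_eq_integral_abs//.
  by under [in X in _ <-> X]eq_integral do rewrite gee0_abs ?lee_fin//.
apply: (iff_trans opt0); apply: (iff_trans int0).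
have drift0 w : drift_from m (deviation t X u) t w = 0 <->
    forall k, (t <= k < nsteps m)%N -> deviation t X u k w = 0.
  split; last first.
    move=> h; rewrite /drift_from big_nat_cond big1// => k /andP[tk _]; exact: h.
  move=> /eqP; rewrite /drift_from big_nat_cond psumr_eq0; last first.
    by move=> k /andP[tk _]; exact: D0.
  move=> /allP h k tk; apply/eqP; have := h k.
  by rewrite mem_index_iota tk => /(_ isT).
have dev0 k w : (t <= k < nsteps m)%N ->
    deviation t X u k w = 0 <-> u k w = feedback m P b k (state m z t X u k w).
  move=> tk; rewrite /deviation; split; last by move=> ->; rewrite subrr expr0n/= mulr0.
  move=> /eqP; rewrite mulf_eq0 sqrf_eq0 subr_eq0 => /orP[|/eqP//].
  by rewrite mulf_eq0 (gt_eqF dt0) orbF (gt_eqF (pos _ tk)).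
split=> [h k tk|h].
  by apply: filterS h => w /(_ I) [] /drift0 /(_ k tk) /dev0; exact.
(* Ranging over ordinals makes the dates finite in number, so their exceptional null sets combine
   into one. *)
have h' : {ae Pr, forall w, forall k : 'I_(nsteps m), (t <= k)%N ->
    u k w = feedback m P b k (state m z t X u k w)}.
  apply: filter_forall => k; have [tk|kt] := leqP t k; last by apply: aeW.
  by apply: filterS (h k _) => [w hw _ //|]; rewrite tk ltn_ord.
apply: filterS h' => w hw _; congr EFin; apply/drift0 => k tk; apply/dev0 => //.
by have /andP[tk' kn] := tk; exact: (hw (Ordinal kn)).
Qed.

(** * The Bellman equation and well-posedness *)

Lemma bellmanE t X u : (t < nsteps m)%N -> convex_from t.+1 ->
  bellman m z t X u = (stage_cost m t X u * dt m
    + (quadratic_form P b e t.+1 (step m t X u 0) + shock_coef2 m P t))%:E.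
Proof.
move=> tn pos; rewrite /bellman EFinD; congr (_ + _)%E.
set q := (_ + _)%R; set A := shock_coef m P b t X u; set c := shock_coef2 m P t.
have icst (a : R) : Pr.-integrable setT (EFin \o cst a) by exact: finite_measure_integrable_cst.
have pcst (a : R) : past_fun z t (cst a) by exact: measurable_cst.
have [i1 e1] := shock_orthogonal iid tn (pcst A) (icst A).
have [i2 e2] := shock2_orthogonal iid tn (pcst c) (icst c).
(* State and action are fixed here, and constants belong to every past, so both noise terms have
   mean zero. *)
transitivity (\int[Pr]_w (q%:E + ((A * z t w)%:E + (c * (z t w ^+ 2 - 1))%:E)))%E.
  by apply: eq_integral => w _; rewrite value_quadratic// quadratic_form_step !EFinD.
rewrite (integralD measurableT (icst q) (integrableD measurableT i1 i2)).
rewrite (integralD measurableT i1 i2) e1 e2 !adde0.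
by have := expectation_cst Pr q; rewrite unlock.
Qed.

Lemma bellman_minimizerP t X u : (t < nsteps m)%N -> convex_from t.+1 ->
  bellman_minimizer m z t X u <->
  forall v, stage_cost m t X u * dt m + quadratic_form P b e t.+1 (step m t X u 0) <=
            stage_cost m t X v * dt m + quadratic_form P b e t.+1 (step m t X v 0).
Proof.
move=> tn pos; rewrite /bellman_minimizer bellmanE//; split => [h v|h].
  have : (ereal_inf (range (bellman m z t X)) <= bellman m z t X v)%E.
    by apply: ereal_inf_lbound; exists v.
  by rewrite -h bellmanE// lee_fin [leLHS]addrA [leRHS]addrA lerD2r.
apply/eqP; rewrite eq_le; apply/andP; split.
  apply: le_ereal_inf_tmp => _ [v _ <-].
  by rewrite bellmanE// lee_fin [leLHS]addrA [leRHS]addrA lerD2r.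
by apply: ereal_inf_lbound; exists u => //; rewrite bellmanE.
Qed.

Lemma bellman_minimizer_feedback t X u : (t < nsteps m)%N -> convex_from t ->
  bellman_minimizer m z t X u <-> u = feedback m P b t X.
Proof.
move=> tn pos; have tkn : (t <= t < nsteps m)%N by rewrite leqnn.
have pos' : convex_from t.+1.
  by move=> k /andP[tk kn]; apply: pos; rewrite kn ltnW.
rewrite bellman_minimizerP//.
have E v : stage_cost m t X v * dt m + quadratic_form P b e t.+1 (step m t X v 0) =
    quadratic_form P b e t X - shock_coef2 m P t
    + vol_ratio m t * coef_g m P t * dt m * (v - feedback m P b t X) ^+ 2.
  have := complete_square X v backPbe tn (sym tn) (gneq0 pos tkn); lra.
have a0 : 0 < vol_ratio m t * coef_g m P t * dt m by rewrite mulr_gt0// pos.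
split=> [/(_ (feedback m P b t X))|-> v].
  rewrite !E lerD2l subrr expr0n/= mulr0 pmulr_rle0// => h.
  by apply/eqP; rewrite -subr_eq0 -sqrf_eq0 eq_le h sqr_ge0.
by rewrite !E lerD2l subrr expr0n/= mulr0 mulr_ge0 ?sqr_ge0// ltW.
Qed.

(** If [al] were at most 0, comparing the minimizer with [u + 1] and [u - 1] would force [al] and
    then [be] to vanish; the constant function so obtained is minimal at [u + 1] as well. *)
Lemma unique_minimizer_gt0 (al be ga : R) :
  (exists! u, forall v, al * u ^+ 2 + be * u + ga <= al * v ^+ 2 + be * v + ga) -> 0 < al.
Proof.
move=> [u [hu uniq]]; rewrite ltNge; apply/negP => al0.
have h1 := hu (u + 1); have h2 := hu (u - 1).
have a0 : al = 0 by apply/eqP; rewrite eq_le al0/=; nra.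
have b0 : be = 0 by apply/eqP; rewrite eq_le; apply/andP; split; nra.
have /eqP : u = u + 1 by apply: uniq => v; rewrite a0 b0 !mul0r.
by rewrite eq_sym -subr_eq0 addrAC subrr add0r oner_eq0.
Qed.

(** For the forward implication, positivity after [k] makes the value at [k.+1] quadratic and hence
    the Bellman expression at [k] a parabola; its unique minimizer then gives positivity at [k]. *)
Lemma well_posedP : well_posed m z <-> convex_from 0.
Proof.
split=> [wp|pos t X tn]; last first.
  have pos' : convex_from t by move=> k /andP[_ kn]; exact: pos.
  exists (feedback m P b t X); split; first exact/bellman_minimizer_feedback.
  by move=> u /(bellman_minimizer_feedback _ _ tn pos').
suff h j : (j <= nsteps m)%N -> convex_from (nsteps m - j) by rewrite -(subnn (nsteps m)); exact: h.
elim: j => [|j IH] jn k /andP[].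
  by rewrite subn0 => nk kn; move: (leq_trans kn nk); rewrite ltnn.
rewrite leq_eqVlt => /orP[/eqP kE kn|]; last first.
  by rewrite -subSn// subSS => jk kn; apply: IH; rewrite ?jk// ltnW.
have pos : convex_from k.+1 by rewrite -kE -subSn// subSS; exact/IH/ltnW.
rewrite -(pmulr_lgt0 _ dt0).
(* The leading coefficient does not depend on the state, so it can be tested at the zero state. *)
have [u [hu uniq]] := wp k 0 kn.
apply: (@unique_minimizer_gt0 _ (vol_ratio m k * dt m * linear_coef m P b k 0)
  (stage_cost m k 0 0 * dt m + quadratic_form P b e k.+1 (step m k 0 0 0))).
exists u; split=> [v|v hv].
  by rewrite -!bellman_quadraticE; exact: (bellman_minimizerP _ _ kn pos).1 hu v.
apply: uniq; apply/(bellman_minimizerP _ _ kn pos) => v'.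
by move: (hv v'); rewrite -!bellman_quadraticE.
Qed.

End control.

Theorem theorem2 (R : realType) (m : market R)
    (d : measure_display) (Omega : measurableType d) (Pr : probability Omega R)
    (z : nat -> {RV Pr >-> R}) :
  0 < dt m ->
  iid_standard_normal m z ->
  exists (P : nat -> 'M[R]_2) (b : nat -> 'cV[R]_2) (e : nat -> R),
    [/\ terminal_conditions m P b e,
        backward_iteration m P b e,
        well_posed m z <->
          (forall t, (t < nsteps m)%N -> 0 < vol_ratio m t * coef_g m P t) &
        well_posed m z ->
        [/\ forall t (X : 'cV[R]_2), (t <= nsteps m)%N ->
              value m z t X = (quadratic_form P b e t X)%:E,
            forall t (X : 'cV[R]_2) (u : R), (t < nsteps m)%N ->
              bellman_minimizer m z t X u <-> u = feedback m P b t X,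
            forall t (X : 'cV[R]_2), (t <= nsteps m)%N ->
              exists u : nat -> Omega -> R, optimal m z t X u &
            forall t (X : 'cV[R]_2) (u : nat -> Omega -> R),
              (t <= nsteps m)%N -> admissible m z t X u ->
              (optimal m z t X u <->
               forall tau, (t <= tau < nsteps m)%N ->
                 {ae Pr, forall w, u tau w =
                   feedback m P b tau (state m z t X u tau w)})]].
Proof.
move=> dt0 iid; have [P [b [e [term back]]]] := backward_iteration_exists m.
exists P, b, e; have wpP := well_posedP dt0 iid term back.
split=> // wp; have pos t : convex_from m P t.
  by move=> k /andP[_ kn]; exact: wpP.1 wp k kn.
split=> [t X tn|t X u tn|t X tn|t X u tn adm].
- exact: (value_quadratic dt0 iid term back).
- exact: (bellman_minimizer_feedback dt0 iid term back).
- exists (feedback_control m z P b t X).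
  exact: (optimal_feedback_control dt0 iid term back).
- exact: (optimalP dt0 iid term back).
Qed.
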